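(* Consider the target-specific punishment problem $PX_n$ (defined in the context) and let $\epsilon>0$. Consider the following method: set $x_n=0$; for each value of $p_n\in[0,1]$ on a discrete grid with interval size $\epsilon$, solve the subproblem of $PX_n$ with these values of $p_n$ and $x_n$ fixed, by casting it as a second-order cone program (SOCP): each constraint $p_n(x_n+\Delta_n)+\delta_{i,n}\le p_i(x_i+\Delta_i)$ whose (now constant) left-hand side is negative is dropped, and each one whose left-hand side is non-negative is rewritten as $$\left\|\left[\kappa_i,\ p_i-x_i-\Delta_i\right]^T\right\|_2\le p_i+x_i+\Delta_i,\qquad \kappa_i=2\sqrt{p_n(x_n+\Delta_n)+\delta_{i,n}};$$ finally return the best solution found over the grid. This method is a fixed-parameter tractable (FPT) additive $\Theta(\epsilon)$-approximation algorithm for solving $PX_n$, the bit precision $K$ of the inputs being the fixed parameter.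
   Context: Audit game with target-specific punishments. There are $n$ targets $t_1,\dots,t_n$ and $k<n$ inspection resources $s_1,\dots,s_k$. A set $R$ of pairs is given, where $(j,i)\in R$ means resource $s_j$ cannot audit target $t_i$. The defender's utilities are $U^a_D(t_i)\ge U^u_D(t_i)$ (target attacked while audited / unaudited), the adversary's are $U^a_A(t_i)\le U^u_A(t_i)$, and $a_1,\dots,a_n>0$ are constants (punishment cost rates). Put $\Delta_{D,i}=U^a_D(t_i)-U^u_D(t_i)\ge 0$, $\Delta_i=U^u_A(t_i)-U^a_A(t_i)\ge 0$, $\delta_{i,j}=U^u_A(t_i)-U^u_A(t_j)$. All inputs are specified with $K$ bits of precision. Problem $PX_n$ (variables $p_i^j$ and $x_1,\dots,x_n$): maximize $p_n\Delta_{D,n}-\sum_{j=1}^n a_jx_j$ subject to (1) $p_i(-x_i-\Delta_i)+p_n(x_n+\Delta_n)+\delta_{i,n}\le 0$ for all $i\ne n$; (2) $0\le\sum_{i=1}^n p_i^j\le 1$ for all $j$; $0\le p_i=\sum_{j=1}^k p_i^j\le 1$ for all $i$; $p_i^j\ge 0$ for all $(j,i)$; $p_i^j=0$ for all $(j,i)\in R$; (3) $0\le x_i\le 1$ for all $i$. An SOCP maximizes a linear objective $f^Ty$ over $y\in\mathbb{R}^N$ subject to linear constraints $Fy=g$ and finitely many constraints $\|A_iy+b_i\|_2\le c_i^Ty+d_i$ (linear inequalities are put in equality form by slack variables). It is taken as known that SOCPs can be solved in polynomial time. An algorithm is FPT (with parameter $K$) if it runs in time polynomial in the input size (and $1/\epsilon$)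 when $K$ is regarded as fixed. It is an additive $\Theta(\epsilon)$-approximation if it outputs a feasible solution whose objective value is smaller than the optimum by at most a constant times $\epsilon$; with the bit precision fixed, each individual input number is regarded as a constant. *)

(* Defs.v *)
From mathcomp Require Import all_boot all_order all_algebra.
From mathcomp Require Import reals.

Set Implicit Arguments.
Unset Strict Implicit.
Unset Printing Implicit Defensive.

Import Order.TTheory GRing.Theory Num.Theory.
Local Open Scope ring_scope.

(* There are n.+1 targets: the distinguished last one is ord_max : 'I_n.+1.  *)
Record audit_game (R : realType) (n k : nat) := AuditGame {
  UDa : 'I_n.+1 -> R;               (* defender, target attacked and audited *)
  UDu : 'I_n.+1 -> R;               (* defender, attacked and unaudited      *)
  UAa : 'I_n.+1 -> R;               (* adversary, attacked and audited       *)
  UAu : 'I_n.+1 -> R;               (* adversary, attacked and unaudited     *)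
  prate : 'I_n.+1 -> R;             (* the punishment cost rates a_i         *)
  forbidden : 'I_k -> 'I_n.+1 -> bool;   (* s_j cannot audit t_i             *)
  UD_le : forall i, UDu i <= UDa i;
  UA_le : forall i, UAa i <= UAu i;
  prate_gt0 : forall i, 0 < prate i
}.

(* A K-bit number: a sign, a K-bit magnitude, and a binary point placed
   anywhere among these K bits.                                              *)
Definition Kbit (R : realType) (K : nat) (x : R) : Prop :=
  exists (m : int) (e : nat),
    [/\ (`|m| < 2 ^ K)%N, (e <= K)%N & x = m%:~R / 2 ^+ e].

Definition game_Kbit (R : realType) (n k K : nat) (G : audit_game R n k) :=
  forall i, [/\ Kbit K (UDa G i), Kbit K (UDu G i), Kbit K (UAa G i),
                Kbit K (UAu G i) & Kbit K (prate G i)].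

(* Five K-bit numbers per target, and the incidence table of [forbidden].    *)
Definition input_size (n k K : nat) : nat := (5 * n.+1 * K + k * n.+1)%N.

Section Problem.
Variables (R : realType) (n k : nat) (G : audit_game R n k).

Definition DeltaD (i : 'I_n.+1) : R := UDa G i - UDu G i.
Definition Delta (i : 'I_n.+1) : R := UAu G i - UAa G i.
Definition delta (i j : 'I_n.+1) : R := UAu G i - UAu G j.

(* A point is (p, x) with p j i standing for p_i^j (resource j, target i).   *)
Definition point : Type := ('M[R]_(k, n.+1) * 'rV[R]_n.+1)%type.

Definition cover (p : 'M[R]_(k, n.+1)) (i : 'I_n.+1) : R := \sum_j p j i.

Definition PX_obj (z : point) : R :=
  cover z.1 ord_max * DeltaD ord_max - \sum_j prate G j * z.2 0 j.

Definition PX_feasible (z : point) : Prop :=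
  let: (p, x) := z in
  [/\ forall i, i != ord_max ->
        cover p i * (- x 0 i - Delta i)
          + cover p ord_max * (x 0 ord_max + Delta ord_max)
          + delta i ord_max <= 0,
      forall j, 0 <= \sum_i p j i <= 1,
      forall i, 0 <= cover p i <= 1,
      (forall j i, 0 <= p j i) /\ (forall j i, forbidden G j i -> p j i = 0)
    & forall i, 0 <= x 0 i <= 1].

Definition PX_optimal (z : point) : Prop :=
  PX_feasible z /\ forall z', PX_feasible z' -> PX_obj z' <= PX_obj z.

(* [out] is a legitimate answer of an algorithm with additive error [err];
   None is the answer "infeasible".                                          *)
Definition PX_approx (err : R) (out : option point) : Prop :=
  if out is Some z then
    PX_feasible z /\
    exists zopt, PX_optimal zopt /\ PX_obj zopt - err <= PX_obj z
  else forall z, ~ PX_feasible z.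

End Problem.

Definition norm2 (R : realType) (m : nat) (v : 'cV[R]_m) : R :=
  Num.sqrt (\sum_i v i 0 ^+ 2).

(* The constraint  || A y + b ||_2 <= c^T y + d  on y : 'cV_N.               *)
Record soc (R : realType) (N : nat) := Soc {
  soc_dim : nat;
  soc_A : 'M[R]_(soc_dim, N);
  soc_b : 'cV[R]_soc_dim;
  soc_c : 'rV[R]_N;
  soc_d : R
}.

(* maximize f^T y  subject to  F y = g  and the cone constraints.            *)
Record socp (R : realType) (N : nat) := Socp {
  socp_f : 'rV[R]_N;
  socp_neq : nat;
  socp_F : 'M[R]_(socp_neq, N);
  socp_g : 'cV[R]_socp_neq;
  socp_cones : seq (soc R N)
}.

Section SOCP.
Variables (R : realType) (N : nat).
Implicit Types (C : soc R N) (P : socp R N) (y : 'cV[R]_N).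

Definition soc_holds C y : bool :=
  norm2 (soc_A C *m y + soc_b C) <= (soc_c C *m y) 0 0 + soc_d C.

Definition socp_feasible P y : Prop :=
  socp_F P *m y = socp_g P /\ all (fun C => soc_holds C y) (socp_cones P).

Definition socp_obj P y : R := (socp_f P *m y) 0 0.

Definition socp_optimal P y : Prop :=
  socp_feasible P y /\
  forall y', socp_feasible P y' -> socp_obj P y' <= socp_obj P y.

Definition soc_nb C : nat := (soc_dim C * N + soc_dim C + N + 1)%N.

Definition socp_nb P : nat :=
  (N + socp_neq P * N + socp_neq P + \sum_(C <- socp_cones P) soc_nb C)%N.

Definition mx_le (M : R) (m p : nat) (A : 'M[R]_(m, p)) : bool :=
  [forall i, forall j, `|A i j| <= M].

Definition soc_le (M : R) C : bool :=
  [&& mx_le M (soc_A C), mx_le M (soc_b C), mx_le M (soc_c C)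
    & `|soc_d C| <= M].

Definition socp_le (M : R) P : bool :=
  [&& mx_le M (socp_f P), mx_le M (socp_F P), mx_le M (socp_g P)
    & all (soc_le M) (socp_cones P)].

End SOCP.

(* Real-RAM cost model: a computation returns its value together with the
   number of elementary steps performed.  An arithmetic operation or square
   root on exact reals, a comparison, the writing of a real number in an
   array, and the control of one loop iteration cost one step each.          *)
Definition timed (A : Type) : Type := (A * nat)%type.

Definition val_of (A : Type) (t : timed A) : A := t.1.
Definition time_of (A : Type) (t : timed A) : nat := t.2.

Definition ret (A : Type) (a : A) : timed A := (a, 0%N).
Definition tick (A : Type) (a : A) : timed A := (a, 1%N).

Definition bind (A B : Type) (t : timed A) (f : A -> timed B) : timed B :=
  let u := f (val_of t) in (val_of u, (time_of t + time_of u)%N).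

Notation "'let!' x ':=' t 'in' u" := (bind t (fun x => u))
  (at level 200, x name, t at level 200, u at level 200,
   format "'[v' 'let!'  x  ':='  t  'in' '/' u ']'").

Definition mxT (R : realType) (m p : nat) (f : 'I_m -> 'I_p -> timed R) :
    timed 'M[R]_(m, p) :=
  (\matrix_(i, j) val_of (f i j), (\sum_i \sum_j (time_of (f i j)).+1)%N).

Definition sumT (R : realType) (m : nat) (f : 'I_m -> timed R) : timed R :=
  (\sum_i val_of (f i), (\sum_i (time_of (f i)).+2)%N).

Definition collectT (A : Type) (s : seq (timed (option A))) : timed (seq A) :=
  (pmap (@val_of _) s, (\sum_(t <- s) (time_of t).+1)%N).

Fixpoint foldT (A B : Type) (f : B -> A -> timed B) (b : B) (s : seq A) :
    timed B :=
  if s is a :: s' then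
    let! b' := f b a in let! _ := tick tt in foldT f b' s'
  else ret b.

(* An SOCP solver.  Its running time is part of the data: it is only
   constrained by socp_solver_polytime.                                      *)
Definition socp_solver (R : realType) : Type :=
  forall N, socp R N -> timed (option 'cV[R]_N).

Definition socp_solver_correct (R : realType) (solve : socp_solver R) : Prop :=
  forall N (P : socp R N),
    ((exists y, socp_optimal P y) ->
       exists2 y, val_of (solve N P) = Some y & socp_optimal P y) /\
    ((forall y, ~ socp_feasible P y) -> val_of (solve N P) = None).

(* Polynomial in the number of data and in the number of bits needed to write
   the integer parts of the data.                                            *)
Definition socp_solver_polytime (R : realType) (solve : socp_solver R) : Prop :=
  exists c d : nat, forall N (P : socp R N) (B : nat),
    socp_le (2 ^+ B) P ->
    (time_of (solve N P) <= c * (socp_nb P + B).+1 ^ d)%N.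

Record lsocp (R : realType) (N : nat) := Lsocp {
  ls_f : 'rV[R]_N;
  ls_eqs : seq ('rV[R]_N * R);           (* (r, b) stands for  r y = b       *)
  ls_ineqs : seq ('rV[R]_N * R);         (* (r, b) stands for  r y <= b      *)
  ls_cones : seq (soc R N)
}.

Section Slack.
Variables (R : realType) (N : nat).

Definition rowsT (N' : nat) (s : seq ('rV[R]_N' * R)) :
    timed ('M[R]_(size s, N') * 'cV[R]_(size s)) :=
  let! F := mxT (fun l j => ret ((nth (0, 0) s l).1 0 j)) in
  let! g := mxT (fun l _ => ret (nth (0, 0) s l).2) in
  ret (F, g).

Definition zeroT (m p : nat) : timed 'M[R]_(m, p) := mxT (fun _ _ => ret 0).

Definition unitT (q : nat) (l : 'I_q) : timed 'rV[R]_q :=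
  mxT (fun _ j => tick (j == l)%:R).

Definition lift_socT (q : nat) (C : soc R N) : timed (soc R (N + q)) :=
  let! ZA := zeroT (soc_dim C) q in
  let! Zc := zeroT 1 q in
  ret (Soc (row_mx (soc_A C) ZA) (soc_b C) (row_mx (soc_c C) Zc) (soc_d C)).

(* The sign constraint 0 <= s_l on the l-th slack variable, written
   || 0 ||_2 <= s_l.                                                         *)
Definition slack_socT (q : nat) (l : 'I_q) : timed (soc R (N + q)) :=
  let! A := zeroT 1 (N + q) in
  let! b := zeroT 1 1 in
  let! Z := zeroT 1 N in
  let! u := unitT l in
  ret (Soc A b (row_mx Z u) 0).

(* The vector of unknowns is  col_mx y s  with  r_l y + s_l = b_l.           *)
Definition slack_formT (L : lsocp R N) :
    timed (socp R (N + size (ls_ineqs L))) :=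
  let q := size (ls_ineqs L) in
  let! Zf := zeroT 1 q in
  let! E := collectT [seq let! Z := zeroT 1 q in
                          ret (Some (row_mx e.1 Z, e.2)) | e <- ls_eqs L] in
  let! I := collectT [seq let! u := unitT l in
                          let e := nth (0, 0) (ls_ineqs L) l in
                          ret (Some (row_mx e.1 u, e.2)) | l <- enum 'I_q] in
  let! Fg := rowsT (E ++ I) in
  let! C := collectT [seq let! C' := lift_socT q C in ret (Some C')
                     | C <- ls_cones L] in
  let! S := collectT [seq let! C' := slack_socT l in ret (Some C')
                     | l <- enum 'I_q] in
  ret (Socp (row_mx (ls_f L) Zf) Fg.1 Fg.2 (C ++ S)).

End Slack.

Section Method.
Variables (R : realType) (solve : socp_solver R).
Variables (n k : nat) (G : audit_game R n k).

Local Notation tn := (@ord_max n).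

(* The unknowns of the subproblem: the p_i^j, row by row, then the x_i.      *)
Local Notation dim := (k * n.+1 + n.+1)%N.

Definition formT (al : 'I_k -> 'I_n.+1 -> timed R) (be : 'I_n.+1 -> timed R) :
    timed 'rV[R]_dim :=
  let! A := mxT al in
  let! b := mxT (fun _ : 'I_1 => be) in
  ret (row_mx (mxvec A) b).

(* Two steps: the selecting conditions used below are conjunctions of at most
   two comparisons of indices.                                               *)
Definition selT (b : bool) (s : R) : timed R :=
  let! _ := tick tt in tick (if b then s else 0).

(* The linear form  s * (sum of the p_i^j such that J j i) +
   t * (sum of the x_i such that I i).                                       *)
Definition selformT (J : 'I_k -> 'I_n.+1 -> bool) (s : R)
    (I : 'I_n.+1 -> bool) (t : R) : timed 'rV[R]_dim :=
  formT (fun j i => selT (J j i) s) (fun i => selT (I i) t).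

Definition pijT j i (s : R) :=
  selformT (fun j' i' => (j' == j) && (i' == i)) s xpred0 0.
Definition pjT j (s : R) := selformT (fun j' _ => j' == j) s xpred0 0.
Definition piT i (s : R) := selformT (fun _ i' => i' == i) s xpred0 0.
Definition xiT i (t : R) := selformT (fun _ _ => false) 0 (pred1 i) t.
Definition pixiT i (s t : R) := selformT (fun _ i' => i' == i) s (pred1 i) t.

Definition constrT (r : timed 'rV[R]_dim) (b : R) :
    timed (option ('rV[R]_dim * R)) :=
  let! r' := r in ret (Some (r', b)).

Definition objT : timed 'rV[R]_dim :=
  let! D := tick (DeltaD G tn) in
  formT (fun _ i => selT (i == tn) D) (fun i => tick (- prate G i)).

Definition eqsT (v : R) : timed (seq ('rV[R]_dim * R)) :=
  collectT ([:: constrT (piT tn 1) v; constrT (xiT tn 1) 0]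
    ++ [seq let! b := tick (forbidden G j i) in
            if b then constrT (pijT j i 1) 0 else ret None
       | j <- enum 'I_k, i <- enum 'I_n.+1]).

Definition ineqsT : timed (seq ('rV[R]_dim * R)) :=
  collectT ([seq constrT (pjT j 1) 1 | j <- enum 'I_k]
    ++ [seq constrT (pjT j (-1)) 0 | j <- enum 'I_k]
    ++ [seq constrT (piT i 1) 1 | i <- enum 'I_n.+1]
    ++ [seq constrT (piT i (-1)) 0 | i <- enum 'I_n.+1]
    ++ [seq constrT (pijT j i (-1)) 0 | j <- enum 'I_k, i <- enum 'I_n.+1]
    ++ [seq constrT (xiT i 1) 1 | i <- enum 'I_n.+1]
    ++ [seq constrT (xiT i (-1)) 0 | i <- enum 'I_n.+1]).

(* w is  p_n (x_n + Delta_n) + delta_{i,n}  with p_n = v and x_n = 0.        *)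
Definition coneT (v : R) (i : 'I_n.+1) : timed (option (soc R dim)) :=
  let! keep := tick (i != tn) in
  if ~~ keep then ret None else
  let! Dn := tick (Delta G tn) in
  let! xD := tick (0 + Dn) in
  let! vD := tick (v * xD) in
  let! di := tick (delta G i tn) in
  let! w := tick (vD + di) in
  let! nonneg := tick (0 <= w) in
  if ~~ nonneg then ret None else
  let! r := tick (Num.sqrt w) in
  let! kappa := tick (2 * r) in
  let! Di := tick (Delta G i) in
  let! nDi := tick (- Di) in
  let! row0 := zeroT R 1 dim in
  let! row1 := pixiT i 1 (-1) in
  let! c := pixiT i 1 1 in
  ret (Some (Soc (col_mx row0 row1)
                 (col_mx (const_mx kappa : 'cV_1) (const_mx nDi : 'cV_1))
                 c Di)).

Definition subproblemT (v : R) : timed (lsocp R dim) :=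
  let! f := objT in
  let! E := eqsT v in
  let! I := ineqsT in
  let! C := collectT [seq coneT v i | i <- enum 'I_n.+1] in
  ret (Lsocp f E I C).

Definition extractT (q : nat) (y : 'cV[R]_(dim + q)) : timed (point R n k) :=
  let u := (usubmx y)^T in
  let! p := mxT (fun j i => ret (vec_mx (lsubmx u) j i)) in
  let! x := mxT (fun i j => ret (rsubmx u i j)) in
  ret (p, x).

Definition valueT (z : point R n k) : timed R :=
  let! pn := sumT (fun j => ret (z.1 j tn)) in
  let! D := tick (DeltaD G tn) in
  let! gain := tick (pn * D) in
  let! loss := sumT (fun i => tick (prate G i * z.2 0 i)) in
  tick (gain - loss).

Definition solve_subproblemT (v : R) : timed (option (point R n k * R)) :=
  let! L := subproblemT v in
  let! P := slack_formT L in
  let! oy := solve P in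
  if oy is Some y then
    let! z := extractT y in
    let! val := valueT z in
    ret (Some (z, val))
  else ret None.

Definition betterT (b b' : option (point R n k * R)) :
    timed (option (point R n k * R)) :=
  match b, b' with
  | None, _ => ret b'
  | _, None => ret b
  | Some zv, Some zv' =>
      let! lt := tick (zv.2 < zv'.2) in ret (if lt then b' else b)
  end.

(* The multiples of eps in [0, 1].  They are listed by the loop
   "p := 0; while p <= 1 do p := p + eps", at the cost of a comparison, an
   addition and a write per point, and of the last comparison.               *)
Definition grid (eps : R) : seq R :=
  [seq eps *+ m | m <- iota 0 (Num.truncn eps^-1).+1].

Definition gridT (eps : R) : timed (seq R) :=
  (grid eps, (3 * size (grid eps)).+1).

Definition methodT (eps : R) : timed (option (point R n k)) :=
  let! g := gridT eps in
  let! best := foldT (fun b v => let! s := solve_subproblemT v in betterT b s)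
                     None g in
  ret (omap fst best).

End Method.

(* Main.v *)
(** Lowering p_n, and setting x_n to 0, only relaxes the constraints of the other
    targets.  Hence an optimal point of PX_n can be moved to the grid value just
    below its p_n, at the cost of at most eps * DeltaD_n in the objective, where
    DeltaD_n <= 2 * 2^K.  For fixed p_n and x_n = 0 the remaining product
    constraints are hyperbolic, and rotate into second-order cones; the feasible
    set is compact, so that each feasible subproblem has an optimum for the
    solver to find.  All the data of the cone program are bounded by 2^(K + 3)
    and there are O((n + 1)^4) of them, which bounds the running time. *)
From mathcomp Require Import all_boot all_order all_algebra.
From mathcomp Require Import reals lra zify.
From mathcomp Require Import classical_sets boolp topology normedtype derive.
Require Import Defs.

Set Implicit Arguments.
Unset Strict Implicit.
Unset Printing Implicit Defensive.

Import Order.TTheory GRing.Theory Num.Theory.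
Import numFieldNormedType.Exports.
Local Open Scope ring_scope.

(** * Attainment of the optimum *)

(** The contract of the solver says nothing about a feasible program without an optimum, so
    attainment is needed for every grid value; the same argument supplies the optimal point demanded
    by [PX_approx]. One discretized number is enough: besides the resource sums, target $n$ meets
    the others only through $p_n(x_n+\Delta_n)$, and scaling all $p_n^j$ by a common factor at most
    1 keeps the forbidden zeros and lowers the resource sums. The rotation is the identity
    $(a+b)^2-(a-b)^2=4ab$ with $a=p_i$ and $b=x_i+\Delta_i$; both factors are non-negative, so a
    constraint with negative left-hand side holds by itself and may be dropped. A timed computation
    is a pair, so correctness and cost are proved apart: values unfold by conversion to values of
    subcomputations, costs to sums of costs. The parameter $K$ enters the error constant and, as
    $K+3$ bits in the bound of the solver, the constant factor of the running time, but never its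
    exponent. *)

Section Encoding.
Variables (R : realType) (n k : nat).
Local Notation dim := (k * n.+1 + n.+1)%N.

Definition decode (u : 'rV[R]_dim) : point R n k :=
  (vec_mx (lsubmx u), rsubmx u).

(** The coordinates are ordered as the unknowns of the subproblem, so that the topology and the
    linear forms of the cone program live on the same vectors. *)
Definition encode (z : point R n k) : 'rV[R]_dim := row_mx (mxvec z.1) z.2.

Lemma encodeK : cancel encode decode.
Proof. by case=> p x; rewrite /encode /decode row_mxKl row_mxKr mxvecK. Qed.

Lemma decodeK : cancel decode encode.
Proof. by move=> u; rewrite /encode /decode vec_mxK hsubmxK. Qed.

Lemma decode1E u j i : (decode u).1 j i = u 0 (lshift _ (mxvec_index j i)).
Proof. by rewrite !mxE. Qed.

Lemma decode2E u i : (decode u).2 0 i = u 0 (rshift _ i).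
Proof. by rewrite !mxE. Qed.

End Encoding.

Section Attainment.
Variables (R : realType) (n k : nat) (G : audit_game R n k).
Local Notation dim := (k * n.+1 + n.+1)%N.
Implicit Types (u : 'rV[R]_dim) (z : point R n k).

Let continuous_sum (I : finType) (f : I -> 'rV[R]_dim -> R) :
  (forall i, continuous (f i)) -> continuous (fun u => \sum_i f i u).
Proof.
move=> cf; apply: continuous_big => // -[x y].
by apply: cvgD; [exact: cvg_fst|exact: cvg_snd].
Qed.

Let continuousRD (f g : 'rV[R]_dim -> R) :
  continuous f -> continuous g -> continuous (fun u => f u + g u).
Proof. by move=> cf cg u; exact: cvgD (cf u) (cg u). Qed.

Let continuousRN (f : 'rV[R]_dim -> R) :
  continuous f -> continuous (fun u => - f u).
Proof. by move=> cf u; exact: cvgN (cf u). Qed.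

Let continuousRM (f g : 'rV[R]_dim -> R) :
  continuous f -> continuous g -> continuous (fun u => f u * g u).
Proof. by move=> cf cg u; exact: cvgM (cf u) (cg u). Qed.

Let continuousR_cst (a : R) : continuous (fun _ : 'rV[R]_dim => a).
Proof. exact: cst_continuous. Qed.

Lemma decode1_continuous j i : continuous (fun u => (decode u).1 j i).
Proof.
have -> : (fun u => (decode u).1 j i) = fun u => u 0 (lshift _ (mxvec_index j i)).
  by apply/funext => u; rewrite decode1E.
exact: coord_continuous.
Qed.

Lemma decode2_continuous i : continuous (fun u => (decode u).2 0 i).
Proof.
have -> : (fun u => (decode u).2 0 i) = fun u => u 0 (rshift _ i).
  by apply/funext => u; rewrite decode2E.
exact: coord_continuous.
Qed.

Lemma cover_continuous i : continuous (fun u => cover (decode u).1 i).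
Proof. by apply: continuous_sum => j; exact: decode1_continuous. Qed.

Lemma PX_obj_continuous : continuous (fun u => PX_obj G (decode u)).
Proof.
apply: continuousRD.
  by apply: continuousRM => //; exact: cover_continuous.
apply/continuousRN/continuous_sum => i.
by apply: continuousRM => //; exact: decode2_continuous.
Qed.

Let closed_le0 (f : 'rV[R]_dim -> R) :
  continuous f -> closed [set u | f u <= 0]%classic.
Proof. by move=> cf; apply: preimage_closed (@closed_le _ 0) => // u _. Qed.

Let closed_eq0 (f : 'rV[R]_dim -> R) (a : R) :
  continuous f -> closed [set u | f u = a]%classic.
Proof. by move=> cf; apply: preimage_closed (@closed_eq _ a) => // u _. Qed.

Let closed_01 (f : 'rV[R]_dim -> R) :
  continuous f -> closed [set u | 0 <= f u <= 1]%classic.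
Proof.
move=> cf; rewrite (_ : mkset _ =
  (f @^-1` [set x | 0 <= x] `&` f @^-1` [set x | x <= 1])%classic).
  by apply: closedI; [apply: preimage_closed (@closed_ge _ 0)
                     |apply: preimage_closed (@closed_le _ 1)] => // u _.
by apply/seteqP; split=> u /=; [move/andP|move=> [-> ->]].
Qed.

Let closed_forall (I : Type) (P : I -> 'rV[R]_dim -> Prop) :
  (forall i, closed [set u | P i u]%classic) ->
  closed [set u | forall i, P i u]%classic.
Proof.
move=> cP; rewrite (_ : mkset _ = \bigcap_(i in setT) [set u | P i u])%classic.
  exact: closed_bigI.
by apply/seteqP; split=> u /= h i; [move=> _|]; exact: h.
Qed.

(** Every constraint is a weak inequality or an equation between continuous functions, and
    quantifiers become arbitrary intersections. *)
Lemma PX_feasible_closed :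
  closed [set u | PX_feasible G (decode u)]%classic.
Proof.
have -> : [set u | PX_feasible G (decode u)]%classic =
  ([set u | forall i, i != ord_max ->
        cover (decode u).1 i * (- (decode u).2 0 i - Delta G i)
          + cover (decode u).1 ord_max * ((decode u).2 0 ord_max + Delta G ord_max)
          + delta G i ord_max <= 0] `&`
   ([set u | forall j, 0 <= \sum_i (decode u).1 j i <= 1] `&`
   ([set u | forall i, 0 <= cover (decode u).1 i <= 1] `&`
   ([set u | forall j i, - (decode u).1 j i <= 0] `&`
   ([set u | forall j i, forbidden G j i -> (decode u).1 j i = 0] `&`
    [set u | forall i, 0 <= (decode u).2 0 i <= 1])))))%classic.
  apply/seteqP; split=> u /=.
    case=> h1 h2 h3 [h4 h5] h6.
    by do 5?[split] => // j i; rewrite oppr_le0.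
  case=> h1 [h2 [h3 [h4 [h5 h6]]]]; split => //; split => // j i.
  by rewrite -oppr_le0.
do ![apply: closedI].
(* The second intersection is indexed by the proofs of [i != ord_max], which disposes of the side
   condition. *)
- apply: closed_forall => i; apply: closed_forall => _.
  apply/closed_le0/continuousRD => //; apply: continuousRD.
    apply: continuousRM; first exact: cover_continuous.
    by apply: continuousRD => //; apply/continuousRN/decode2_continuous.
  apply: continuousRM; first exact: cover_continuous.
  by apply: continuousRD => //; exact: decode2_continuous.
- apply: closed_forall => j; apply/closed_01/continuous_sum => i.
  exact: decode1_continuous.
- by apply: closed_forall => i; apply/closed_01/cover_continuous.
- apply: closed_forall => j; apply: closed_forall => i.
  exact/closed_le0/continuousRN/decode1_continuous.
- apply: closed_forall => j; apply: closed_forall => i.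
  apply: closed_forall => _; apply: closed_eq0; exact: decode1_continuous.
- by apply: closed_forall => i; apply/closed_01/decode2_continuous.
Qed.

(** Boundedness half of compactness: each $p_i^j$ is one non-negative summand of $p_i\le 1$. *)
Lemma PX_feasible_le1 u l : PX_feasible G (decode u) -> `|u 0 l| <= 1.
Proof.
rewrite -[u]decodeK; case: (decode u) => p x; rewrite encodeK.
case=> _ _ hcov [p0 _] hx; rewrite /encode mxE; case: splitP => i _.
  case/mxvec_indexP: i => j i; rewrite mxvecE ger0_norm //.
  have /andP[_] := hcov i; apply: le_trans.
  by rewrite /cover (bigD1 j) //= lerDl sumr_ge0.
by have /andP[? ?] := hx i; rewrite ger0_norm.
Qed.

(** Extreme value theorem on a compact set. The closed set [A] serves two uses: the whole space for
    the problem itself, and the fixed values of $p_n$ and $x_n$ for a subproblem. *)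
Lemma PX_max_exists (A : set 'rV[R]_dim) : closed A ->
  (exists z, PX_feasible G z /\ A (encode z)) ->
  exists z, [/\ PX_feasible G z, A (encode z) &
    forall z', PX_feasible G z' -> A (encode z') -> PX_obj G z' <= PX_obj G z].
Proof.
move=> cA [z0 [fz0 Az0]].
pose F := ([set u | PX_feasible G (decode u)] `&` A)%classic.
have [|||u Fu umax] := @EVT_max_rV R _ (fun u => PX_obj G (decode u)) F.
- by exists (encode z0); rewrite /F /setI /mkset encodeK.
- apply: bounded_closed_compact; last first.
    by apply: closedI => //; exact: PX_feasible_closed.
  exists 1; split => // M M1 u [fu _] /=.
  rewrite [leLHS]/Num.norm/= mx_normrE; apply: bigmax_le; first lra.
  by move=> [i j] _ /=; rewrite (ord1 i) (le_trans (PX_feasible_le1 j fu)) ?ltW.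
- by apply: continuous_subspaceT; exact: PX_obj_continuous.
move: Fu; rewrite in_setE => -[fu Au].
exists (decode u); split; rewrite ?decodeK // => z' fz' Az'.
rewrite -[z' in leLHS]encodeK; apply: umax; rewrite in_setE.
by split; rewrite /mkset ?encodeK.
Qed.

Lemma PX_optimal_exists : (exists z, PX_feasible G z) -> exists z, PX_optimal G z.
Proof.
case=> z fz; have [|z' [fz' _ zm]] := PX_max_exists (@closedT _).
  by exists z.
by exists z'; split => // z'' fz''; exact: zm.
Qed.

(** The subproblem at grid value [v] before any recasting; the cone program is measured against
    it. *)
Definition PX_slice (v : R) z : Prop :=
  [/\ PX_feasible G z, cover z.1 ord_max = v & z.2 0 ord_max = 0].

Lemma PX_slice_max_exists v : (exists z, PX_slice v z) ->
  exists2 z, PX_slice v z & forall z', PX_slice v z' -> PX_obj G z' <= PX_obj G z.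
Proof.
case=> z0 [fz0 z0v z00].
have cA : closed ([set u | cover (decode u).1 ord_max = v] `&`
    [set u : 'rV[R]_dim | (decode u).2 0 ord_max = 0])%classic.
  by apply: closedI; apply: closed_eq0;
    [exact: cover_continuous|exact: decode2_continuous].
have [|z [fz []]] := PX_max_exists cA.
  by exists z0; split => //; split; rewrite /mkset encodeK.
rewrite /mkset encodeK => zv zx zm; exists z => // z' [fz' zv' z0'].
by apply: zm => //; split; rewrite /mkset encodeK.
Qed.

End Attainment.


(** * Slack form and subproblem *)

(** [collectT] discards [None], so an omitted constraint counts as satisfied. *)
Lemma all_collectT (A : Type) (P : pred A) (s : seq (timed (option A))) :
  all P (val_of (collectT s)) =
  all (fun t => if val_of t is Some x then P x else true) s.
Proof.
by rewrite /collectT /val_of /=; elim: s => //= -[[x|] m] s /= ->.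
Qed.

Lemma all_enumE (T : finType) (P : pred T) : all P (enum T) = [forall x, P x].
Proof.
by apply/allP/forallP => h x => [|_]; apply: h; rewrite mem_enum.
Qed.

Section SlackSemantics.
Variables (R : realType) (N : nat).

Lemma rowsTP N' (s : seq ('rV[R]_N' * R)) (y : 'cV[R]_N') :
  (val_of (rowsT s)).1 *m y = (val_of (rowsT s)).2 <->
  all (fun e => (e.1 *m y) 0 0 == e.2) s.
Proof.
have eqF l : ((val_of (rowsT s)).1 *m y) l 0 = ((nth (0, 0) s l).1 *m y) 0 0.
  by rewrite !mxE; apply: eq_bigr => j _; rewrite !mxE.
split=> [Fg|/(all_nthP (0, 0)) h].
  apply/(all_nthP (0, 0)) => l ltl; apply/eqP.
  by have := eqF (Ordinal ltl); rewrite Fg !mxE => <-.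
apply/matrixP => l c; rewrite (ord1 c) eqF (eqP (h l (ltn_ord l))).
by rewrite !mxE.
Qed.

Lemma zeroTE m p : val_of (zeroT R m p) = 0.
Proof. by apply/matrixP => i j; rewrite !mxE. Qed.

Lemma unitT_mul q (l : 'I_q) (s : 'cV[R]_q) :
  (val_of (unitT R l) *m s) 0 0 = s l 0.
Proof.
rewrite mxE (bigD1 l) //= big1 ?addr0 => [|j /negPf jl];
  by rewrite !mxE /= ?eqxx ?mul1r // jl mul0r.
Qed.

Definition lsocp_feasible (L : lsocp R N) (y : 'cV[R]_N) : Prop :=
  [/\ all (fun e => (e.1 *m y) 0 0 == e.2) (ls_eqs L),
      all (fun e => (e.1 *m y) 0 0 <= e.2) (ls_ineqs L)
    & all (fun C => soc_holds C y) (ls_cones L)].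

Lemma lift_soc_holds q (C : soc R N) (y : 'cV[R]_N) (s : 'cV[R]_q) :
  soc_holds (val_of (lift_socT q C)) (col_mx y s) = soc_holds C y.
Proof.
rewrite (_ : val_of (lift_socT q C) =
  Soc (row_mx (soc_A C) (val_of (zeroT R _ q))) (soc_b C)
      (row_mx (soc_c C) (val_of (zeroT R 1 q))) (soc_d C)) //.
by rewrite /soc_holds !zeroTE /= !mul_row_col !mul0mx !addr0.
Qed.

Lemma slack_soc_holds q (l : 'I_q) (y : 'cV[R]_N) (s : 'cV[R]_q) :
  soc_holds (val_of (slack_socT R N l)) (col_mx y s) = (0 <= s l 0).
Proof.
rewrite (_ : val_of (slack_socT R N l) =
  Soc (val_of (zeroT R 1 (N + q))) (val_of (zeroT R 1 1))
      (row_mx (val_of (zeroT R 1 N)) (val_of (unitT R l))) 0) //.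
rewrite /soc_holds !zeroTE /= mul_row_col !mul0mx addr0 add0r unitT_mul addr0.
by rewrite /norm2 big_ord1 mxE expr0n sqrtr0.
Qed.

Section Form.
Variable L : lsocp R N.
Local Notation q := (size (ls_ineqs L)).

Lemma slack_form_obj y s :
  socp_obj (val_of (slack_formT L)) (col_mx y s) = (ls_f L *m y) 0 0.
Proof.
rewrite /socp_obj (_ : socp_f _ = row_mx (ls_f L) (val_of (zeroT R 1 q))) //.
by rewrite mul_row_col zeroTE mul0mx addr0.
Qed.

(** Zero blocks hide the slacks from the equations and the original cones, while a unit block adds
    exactly the slack of its own inequality. *)
Lemma slack_form_feasible y s :
  socp_feasible (val_of (slack_formT L)) (col_mx y s) <->
  [/\ all (fun e => (e.1 *m y) 0 0 == e.2) (ls_eqs L),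
      forall l : 'I_q, let e := nth (0, 0) (ls_ineqs L) l in
        (e.1 *m y) 0 0 + s l 0 = e.2,
      all (fun C => soc_holds C y) (ls_cones L)
    & forall l, 0 <= s l 0].
Proof.
rewrite /socp_feasible.
(* The fields of the computed program are convertible to values of the subcomputations; this pattern
   of folding recurs below. *)
rewrite -[X in X /\ _]/((val_of (rowsT _)).1 *m _ = (val_of (rowsT _)).2).
rewrite rowsTP [socp_cones _]/= !all_cat.
have -> : all (fun e : 'rV_(N + q) * R => (e.1 *m col_mx y s) 0 0 == e.2)
    (val_of (collectT [seq let! Z := zeroT R 1 q in
                          ret (Some (row_mx e.1 Z, e.2)) | e <- ls_eqs L])) =
  all (fun e => (e.1 *m y) 0 0 == e.2) (ls_eqs L).
  rewrite all_collectT all_map; apply: eq_all => e.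
  rewrite -[LHS]/((row_mx e.1 (val_of (zeroT R 1 q)) *m col_mx y s) 0 0 == e.2).
  by rewrite mul_row_col zeroTE mul0mx addr0.
have -> : all (fun e : 'rV_(N + q) * R => (e.1 *m col_mx y s) 0 0 == e.2)
    (val_of (collectT [seq let! u := unitT R l in
                          let e := nth (0, 0) (ls_ineqs L) l in
                          ret (Some (row_mx e.1 u, e.2)) | l <- enum 'I_q])) =
  [forall l : 'I_q, let e := nth (0, 0) (ls_ineqs L) l in
        (e.1 *m y) 0 0 + s l 0 == e.2].
  rewrite all_collectT all_map all_enumE; apply: eq_forallb => l.
  rewrite -[LHS]/((row_mx (nth (0, 0) (ls_ineqs L) l).1 (val_of (unitT R l))
    *m col_mx y s) 0 0 == (nth (0, 0) (ls_ineqs L) l).2).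
  by rewrite mul_row_col mxE unitT_mul.
rewrite !all_collectT 2!all_map all_enumE.
rewrite [in X in _ /\ X <-> _](eq_all (a2 := fun C => soc_holds C y)); last first.
  by move=> C; rewrite -(lift_soc_holds C y s).
rewrite [in X in _ /\ X <-> _](eq_forallb (P2 := fun l => 0 <= s l 0)); last first.
  by move=> l; rewrite -(slack_soc_holds l y s).
split.
  by case=> /andP[-> /forallP hI] /andP[-> /forallP hS]; split=> // l; exact/eqP.
case=> -> hI -> hS; split=> /=; first by apply/forallP => l; exact/eqP.
exact/forallP.
Qed.

Lemma slack_form_usub Y :
  socp_feasible (val_of (slack_formT L)) Y -> lsocp_feasible L (usubmx Y).
Proof.
rewrite -{1}[Y]vsubmxK => /slack_form_feasible[hE hI hC hS]; split=> //.
apply/(all_nthP (0, 0)) => l ltl.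
by rewrite -(hI (Ordinal ltl)) lerDl hS.
Qed.

Lemma slack_form_extend y : lsocp_feasible L y ->
  exists s, socp_feasible (val_of (slack_formT L)) (col_mx y s).
Proof.
case=> hE hI hC; exists (\col_l ((nth (0, 0) (ls_ineqs L) l).2 -
  ((nth (0, 0) (ls_ineqs L) l).1 *m y) 0 0)).
apply/slack_form_feasible; split=> // l; rewrite mxE.
  by rewrite /= addrC subrK.
by rewrite subr_ge0; exact: (all_nthP (0, 0) hI).
Qed.

End Form.
End SlackSemantics.

(** * Linear forms, hyperbolic cones and the answer of the solver *)

Section Semantics.
Variables (R : realType) (n k : nat) (G : audit_game R n k).
Local Notation dim := (k * n.+1 + n.+1)%N.
Local Notation tn := (@ord_max n).
Implicit Types z : point R n k.

Definition eval_form (r : 'rV[R]_dim) z : R := (r *m (encode z)^T) 0 0.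

Lemma formT_eval al be z :
  eval_form (val_of (formT al be)) z =
  \sum_j \sum_i val_of (al j i) * z.1 j i + \sum_i val_of (be i) * z.2 0 i.
Proof.
rewrite /eval_form /encode tr_row_mx mul_row_col mxE; congr (_ + _).
  rewrite mxE (reindex _ (curry_mxvec_bij _ _)) pair_bigA.
  by apply: eq_bigr => -[j i] _; rewrite mxE !mxvecE mxE.
by rewrite mxE; apply: eq_bigr => i _; rewrite !mxE.
Qed.

Lemma selformT_eval J s I t z :
  eval_form (val_of (selformT J s I t)) z =
  \sum_j \sum_i (if J j i then s else 0) * z.1 j i +
  \sum_i (if I i then t else 0) * z.2 0 i.
Proof. exact: formT_eval. Qed.

Let sum_if (T : finType) (P : pred T) (a : R) (F : T -> R) :
  \sum_i (if P i then a else 0) * F i = a * \sum_(i | P i) F i.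
Proof.
rewrite mulr_sumr [RHS]big_mkcond.
by apply: eq_bigr => i _; case: ifP; rewrite ?mul0r.
Qed.

Let sum_x0 z : \sum_i 0 * z.2 0 i = 0 :> R.
Proof. by apply: big1 => i _; rewrite mul0r. Qed.

Lemma piT_eval i s z : eval_form (val_of (piT k i s)) z = s * cover z.1 i.
Proof.
rewrite selformT_eval /= sum_x0 addr0 /cover mulr_sumr.
by apply: eq_bigr => j _; rewrite sum_if big_pred1_eq.
Qed.

Lemma pjT_eval j s z :
  eval_form (val_of (pjT n j s)) z = s * \sum_i z.1 j i.
Proof.
rewrite selformT_eval /= sum_x0 addr0 (bigD1 j) //=.
rewrite [X in _ + X]big1 ?addr0 => [|j' /negPf jj]; last first.
  by apply: big1 => i _; rewrite jj mul0r.
by rewrite mulr_sumr; apply: eq_bigr => i _; rewrite eqxx.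
Qed.

Lemma pijT_eval j i s z : eval_form (val_of (pijT j i s)) z = s * z.1 j i.
Proof.
rewrite selformT_eval /= sum_x0 addr0 (bigD1 j) //=.
rewrite [X in _ + X]big1 ?addr0 => [|j' /negPf jj]; last first.
  by apply: big1 => i' _; rewrite jj mul0r.
by rewrite eqxx /= sum_if big_pred1_eq.
Qed.

Lemma pixiT_eval i s t z :
  eval_form (val_of (pixiT k i s t)) z = s * cover z.1 i + t * z.2 0 i.
Proof.
rewrite selformT_eval /= sum_if big_pred1_eq /cover mulr_sumr; congr (_ + _).
by apply: eq_bigr => j _; rewrite sum_if big_pred1_eq.
Qed.

Lemma xiT_eval i t z : eval_form (val_of (xiT k i t)) z = t * z.2 0 i.
Proof.
rewrite selformT_eval /= sum_if big_pred1_eq big1 ?add0r // => j _.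
by apply: big1 => i' _; rewrite mul0r.
Qed.

Lemma objT_eval z : eval_form (val_of (objT G)) z = PX_obj G z.
Proof.
rewrite formT_eval /PX_obj /cover mulrC mulr_sumr; congr (_ + _).
  by apply: eq_bigr => j _; rewrite sum_if big_pred1_eq.
by rewrite -sumrN; apply: eq_bigr => i _; rewrite mulNr.
Qed.

Definition eq_holds z (e : 'rV[R]_dim * R) := eval_form e.1 z == e.2.
Definition ineq_holds z (e : 'rV[R]_dim * R) := eval_form e.1 z <= e.2.

Lemma eqsT_holds v z : all (eq_holds z) (val_of (eqsT G v)) <->
  [/\ cover z.1 tn = v, z.2 0 tn = 0
    & forall j i, forbidden G j i -> z.1 j i = 0].
Proof.
rewrite all_collectT /= /eq_holds piT_eval xiT_eval !mul1r; split.
  case/and3P=> /eqP -> /eqP -> /all_allpairsP h; split=> // j i fji; apply/eqP.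
  have := h j i (mem_enum _ _) (mem_enum _ _).
  by rewrite /= fji /= pijT_eval mul1r.
case=> -> -> h; rewrite !eqxx /=; apply/all_allpairsP => j i _ _ /=.
by case: ifP => // fji; rewrite /= pijT_eval mul1r h.
Qed.

Lemma ineqsT_holds z : all (ineq_holds z) (val_of (ineqsT R n k)) <->
  [/\ forall j, 0 <= \sum_i z.1 j i <= 1,
      forall i, 0 <= cover z.1 i <= 1,
      forall j i, 0 <= z.1 j i
    & forall i, 0 <= z.2 0 i <= 1].
Proof.
rewrite all_collectT !all_cat 6!all_map !all_enumE /ineq_holds.
split.
  case/andP=> /forallP h1 /and5P[/forallP h2 /forallP h3 /forallP h4].
  move=> /all_allpairsP h5 /andP[/forallP h6 /forallP h7].
  split=> [j|i|j i|i].
  - have := h1 j; have := h2 j; rewrite /= !pjT_eval; lra.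
  - have := h3 i; have := h4 i; rewrite /= !piT_eval; lra.
  - have := h5 j i (mem_enum _ _) (mem_enum _ _); rewrite /= pijT_eval; lra.
  - have := h6 i; have := h7 i; rewrite /= !xiT_eval; lra.
case=> h1 h2 h3 h4.
apply/and5P; split; try apply/forallP => l; last apply/and3P; try split.
- by have := h1 l; rewrite /= pjT_eval; lra.
- by have := h1 l; rewrite /= pjT_eval; lra.
- by have := h2 l; rewrite /= piT_eval; lra.
- by have := h2 l; rewrite /= piT_eval; lra.
- apply/all_allpairsP => j i _ _ /=; have := h3 j i; rewrite pijT_eval; lra.
- by apply/forallP => l; have := h4 l; rewrite /= xiT_eval; lra.
- by apply/forallP => l; have := h4 l; rewrite /= xiT_eval; lra.
Qed.

(** Squaring is an equivalence only for a non-negative right-hand side, hence the separate sign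
    condition. *)
Lemma norm2_le2 (a b c : R) :
  (norm2 (col_mx (const_mx a : 'cV_1) (const_mx b : 'cV_1)) <= c) =
  (0 <= c) && (a ^+ 2 + b ^+ 2 <= c ^+ 2).
Proof.
rewrite /norm2 big_split_ord !big_ord1 col_mxEu col_mxEd !mxE.
have ab : 0 <= a ^+ 2 + b ^+ 2 by rewrite addr_ge0 ?sqr_ge0.
have [c0|c0] /= := leP 0 c; last first.
  by apply/negbTE; rewrite -ltNge (lt_le_trans c0) ?sqrtr_ge0.
by rewrite -ler_sqr ?nnegrE ?sqrtr_ge0 // sqr_sqrtr.
Qed.

Definition hyperbolic_soc (kappa : R) (i : 'I_n.+1) : soc R dim :=
  Soc (col_mx (val_of (zeroT R 1 dim)) (val_of (pixiT k i 1 (-1))))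
      (col_mx (const_mx kappa : 'cV_1) (const_mx (- Delta G i) : 'cV_1))
      (val_of (pixiT k i 1 1)) (Delta G i).

Definition cone_lhs (v : R) (i : 'I_n.+1) : R :=
  v * (0 + Delta G tn) + delta G i tn.

Lemma coneT_val v i : val_of (coneT G v i) =
  if (i != tn) && (0 <= cone_lhs v i) then
    Some (hyperbolic_soc (2 * Num.sqrt (cone_lhs v i)) i) else None.
Proof.
rewrite /coneT; case: (i != tn) => //=; rewrite -/(cone_lhs v i).
by case: (0 <= cone_lhs v i).
Qed.

(** After squaring, the difference of the squares of $p_i+x_i+\Delta_i$ and $p_i-x_i-\Delta_i$ is
    $4p_i(x_i+\Delta_i)$. *)
Lemma hyperbolic_soc_holds kappa i z :
  soc_holds (hyperbolic_soc kappa i) (encode z)^T =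
  (0 <= cover z.1 i + z.2 0 i + Delta G i) &&
  (kappa ^+ 2 <= 4 * cover z.1 i * (z.2 0 i + Delta G i)).
Proof.
rewrite /hyperbolic_soc /soc_holds zeroTE /=.
rewrite mul_col_mx add_col_mx mul0mx add0r.
rewrite -[(_ *m _) 0 0]/(eval_form (val_of (pixiT k i 1 1)) z) pixiT_eval !mul1r.
have -> : val_of (pixiT k i 1 (-1)) *m (encode z)^T + const_mx (- Delta G i) =
    const_mx (cover z.1 i - z.2 0 i - Delta G i) :> 'cV_1.
  apply/matrixP => a b; rewrite (ord1 a) (ord1 b) [LHS]mxE.
  rewrite -[X in X + _]/(eval_form (val_of (pixiT k i 1 (-1))) z).
  by rewrite pixiT_eval !mxE mul1r mulN1r.
rewrite norm2_le2; congr (_ && _); apply/idP/idP; lra.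
Qed.

(** If the left-hand side $w$ is negative, no cone is emitted and the constraint follows from
    $p_i(x_i+\Delta_i)\ge 0$; otherwise $\kappa_i^2=4w$ gives back $w\le p_i(x_i+\Delta_i)$. *)
Lemma coneT_holds v i z : cover z.1 tn = v -> z.2 0 tn = 0 ->
  0 <= cover z.1 i -> 0 <= z.2 0 i ->
  is_true (if val_of (coneT G v i) is Some C then soc_holds C (encode z)^T
           else true) <->
  (i != tn -> cover z.1 i * (- z.2 0 i - Delta G i)
          + cover z.1 ord_max * (z.2 0 ord_max + Delta G ord_max)
          + delta G i ord_max <= 0).
Proof.
move=> -> -> p0 x0; rewrite coneT_val.
have [->|itn] := eqVneq i tn; first by [].
have D0 : 0 <= Delta G i by rewrite subr_ge0 UA_le.
have pxD : 0 <= cover z.1 i * (z.2 0 i + Delta G i).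
  by apply: mulr_ge0 => //; exact: addr_ge0.
have [w0|w0] := leP 0 (cone_lhs v i); last first.
  by rewrite /cone_lhs in w0; split=> // _ _; lra.
have s0 : 0 <= cover z.1 i + z.2 0 i + Delta G i by lra.
rewrite -[X in X <-> _]/(is_true (soc_holds (hyperbolic_soc _ i) (encode z)^T)).
rewrite hyperbolic_soc_holds exprMn sqr_sqrtr // s0 andTb.
by rewrite /cone_lhs in w0 *; split=> [h _|/(_ isT)]; lra.
Qed.

(** The linear constraints are translated before the cones, because they supply the signs of $p_i$
    and $x_i$ on which the rotation depends. *)
Lemma subproblem_feasible v z :
  lsocp_feasible (val_of (subproblemT G v)) (encode z)^T <-> PX_slice G v z.
Proof.
rewrite /lsocp_feasible -[ls_eqs _]/(val_of (eqsT G v)).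
rewrite -[ls_ineqs _]/(val_of (ineqsT R n k)).
rewrite -[ls_cones _]/(val_of (collectT [seq coneT G v i | i <- enum 'I_n.+1])).
rewrite all_collectT all_map all_enumE.
split.
  case=> /eqsT_holds[zv zx zR] /ineqsT_holds[h2 h3 h4 h5] /forallP h1.
  split=> //; rewrite [z]surjective_pairing; split=> // i.
  have /andP[p0 _] := h3 i; have /andP[x0 _] := h5 i.
  exact: (coneT_holds zv zx p0 x0).1 (h1 i).
case: z => p x [[h1 h2 h3 [h4 h5] h6] zv zx]; split.
- exact/eqsT_holds.
- exact/ineqsT_holds.
apply/forallP => i; apply/coneT_holds => //=.
- by case/andP: (h3 i).
- by case/andP: (h6 i).
- exact: h1.
Qed.

Section Subproblem.
Variables (solve : socp_solver R) (solve_correct : socp_solver_correct solve).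

Lemma extractT_val q (Y : 'cV[R]_(dim + q)) :
  val_of (extractT Y) = decode (usubmx Y)^T.
Proof.
by rewrite /decode; congr (_, _); apply/matrixP => i j; rewrite [LHS]mxE.
Qed.

Lemma subproblem_obj v z s :
  socp_obj (val_of (slack_formT (val_of (subproblemT G v))))
    (col_mx (encode z)^T s) = PX_obj G z.
Proof. by rewrite slack_form_obj -objT_eval. Qed.

Variant subproblem_spec v : option (point R n k * R) -> Prop :=
| SubproblemInfeasible of (forall z, ~ PX_slice G v z) : subproblem_spec v None
| SubproblemSolved z of PX_slice G v z &
    (forall z', PX_slice G v z' -> PX_obj G z' <= PX_obj G z) :
    subproblem_spec v (Some (z, PX_obj G z)).

Lemma solve_subproblemP v :
  subproblem_spec v (val_of (solve_subproblemT solve G v)).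
Proof.
set P := val_of (slack_formT (val_of (subproblemT G v))).
have -> : val_of (solve_subproblemT solve G v) =
    omap (fun Y => (decode (usubmx Y)^T, PX_obj G (decode (usubmx Y)^T)))
      (val_of (solve P)).
  rewrite /solve_subproblemT -[LHS]/(val_of (let! oy := solve P in
    if oy is Some y then
      let! z := extractT y in let! val := valueT G z in ret (Some (z, val))
    else ret None)).
  rewrite [LHS]/=; case: (val_of (solve P)) => //= Y.
  by rewrite -extractT_val.
have feasP Y : socp_feasible P Y -> PX_slice G v (decode (usubmx Y)^T).
  move/slack_form_usub => h; apply/subproblem_feasible.
  by rewrite decodeK trmxK.
have feasE z : PX_slice G v z -> exists s, socp_feasible P (col_mx (encode z)^T s).
  by move=> /subproblem_feasible; exact: slack_form_extend.
have objP Y : socp_obj P Y = PX_obj G (decode (usubmx Y)^T).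
  have {1}-> : Y = col_mx (encode (decode (usubmx Y)^T))^T (dsubmx Y).
    by rewrite decodeK trmxK vsubmxK.
  exact: subproblem_obj.
have [[z zv]|noz] := pselect (exists z, PX_slice G v z); last first.
  have nofeas Y : ~ socp_feasible P Y by move/feasP => ?; apply: noz; eexists; eauto.
  rewrite (solve_correct P).2 //=; constructor => z zv.
  by apply: noz; exists z.
(* An optimum of the slice, completed by its slacks, is an optimum of the program; only now is the
   solver bound to answer. *)
have [z0 z0v z0max] := PX_slice_max_exists (ex_intro _ z zv).
have [s sfeas] := feasE _ z0v.
have [|Y -> [Yfeas Ymax]] := (solve_correct P).1.
  exists (col_mx (encode z0)^T s); split=> // Y /feasP Yv.
  by rewrite objP subproblem_obj z0max.
rewrite /=; constructor; first exact: feasP.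
move=> z' z'v; have [s' s'feas] := feasE _ z'v.
by have := Ymax _ s'feas; rewrite subproblem_obj objP.
Qed.

End Subproblem.
End Semantics.

(** * Rounding to the grid *)

Section Correctness.
Variables (R : realType) (n k : nat) (G : audit_game R n k).
Local Notation tn := (@ord_max n).
Implicit Types z : point R n k.

(** Column [tn] of [p] is scaled by [v / c] and $x_n$ is set to 0. The other covers and punishments
    are untouched and the punishment cost can only drop, so the loss is confined to the term
    $p_n\Delta_{D,n}$. *)
Lemma PX_slice_round_down v z : PX_feasible G z -> 0 <= v <= cover z.1 tn ->
  exists2 z', PX_slice G v z' &
    PX_obj G z - (cover z.1 tn - v) * DeltaD G tn <= PX_obj G z'.
Proof.
case: z => p x [h1 h2 h3 [h4 h5] h6] /= /andP[v0 vc].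
set c := cover p tn in h1 vc *.
have c0 : 0 <= c by case/andP: (h3 tn).
(* If [c = 0] then [v = 0], and the convention that the inverse of 0 is 0 makes the factor 0, which
   is still correct. *)
have r01 : 0 <= v / c <= 1.
  have [c_gt0|] := ltP 0 c; first by rewrite divr_ge0 ?ler_pdivrMr ?mul1r.
  by move=> cle0; have -> : c = 0 by [lra]; rewrite invr0 mulr0; lra.
pose p' : 'M[R]_(k, n.+1) := \matrix_(j, i) (if i == tn then v / c * p j i else p j i).
pose x' : 'rV[R]_n.+1 := \row_i (if i == tn then 0 else x 0 i).
have p'E j i : i != tn -> p' j i = p j i by move=> /negPf itn; rewrite mxE itn.
have x'E i : i != tn -> x' 0 i = x 0 i by move=> /negPf itn; rewrite mxE itn.
have coverE i : i != tn -> cover p' i = cover p i.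
  by move=> itn; apply: eq_bigr => j _; rewrite p'E.
have coverv : cover p' tn = v.
  rewrite /cover; under eq_bigr do rewrite mxE eqxx.
  rewrite -mulr_sumr -/(cover p tn) -/c.
  have [c_eq0|cn0] := eqVneq c 0; last by rewrite divfK.
  by rewrite c_eq0 mulr0; lra.
have x'tn : x' 0 tn = 0 by rewrite mxE eqxx.
have p'ge0 j i : 0 <= p' j i.
  by rewrite mxE; case: ifP => // _; rewrite mulr_ge0 //; case/andP: r01.
have p'le j i : p' j i <= p j i.
  by rewrite mxE; case: ifP => // _; rewrite ler_piMl //; case/andP: r01.
have x'ge0 i : 0 <= x' 0 i.
  by rewrite mxE; case: ifP => // _; case/andP: (h6 i).
have x'le i : x' 0 i <= x 0 i.
  by rewrite mxE; case: ifP => // _; case/andP: (h6 i).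
have D0 : 0 <= Delta G tn by rewrite subr_ge0 UA_le.
exists (p', x').
  split=> //; split=> [i itn|j|i||i].
  - rewrite coverE // x'E // coverv x'tn.
    (* The coupling term decreases: $v\Delta_n\le c\Delta_n\le c(x_n+\Delta_n)$. *)
    have := h1 i itn; have : 0 <= c * x 0 tn.
      by apply: mulr_ge0 => //; case/andP: (h6 tn).
    by have : v * Delta G tn <= c * Delta G tn by [exact: ler_wpM2r]; lra.
  - rewrite sumr_ge0 //=; have /andP[_] := h2 j; apply: le_trans.
    exact: ler_sum.
  - rewrite sumr_ge0 //=; have /andP[_] := h3 i; apply: le_trans.
    exact: ler_sum.
  - split=> // j i fji; rewrite mxE h5 // mulr0; exact: if_same.
  - by rewrite x'ge0 /=; have /andP[_] := h6 i; apply: le_trans.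
rewrite /PX_obj coverv -/c /=.
have : \sum_j prate G j * x' 0 j <= \sum_j prate G j * x 0 j.
  by apply: ler_sum => j _; rewrite ler_pM2l ?prate_gt0.
lra.
Qed.

(** The witness is the multiple of [eps] with factor the integer part of [c / eps]; it is listed
    because $c\le 1$. *)
Lemma grid_below (eps c : R) : 0 < eps -> 0 <= c <= 1 ->
  exists2 v, v \in grid eps & [/\ 0 <= v, v <= c & c - v <= eps].
Proof.
move=> eps0 /andP[c0 c1]; exists (eps *+ Num.truncn (c / eps)).
  apply/map_f; rewrite mem_iota add0n ltnS /=; apply: le_truncn.
  by rewrite -[leRHS]mul1r ler_pM2r ?invr_gt0.
have /truncn_itv/andP[lo hi] : 0 <= c / eps by rewrite divr_ge0 // ltW.
rewrite -mulr_natl mulr_ge0 ?ler0n ?(ltW eps0) // -ler_pdivlMr //.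
split=> //; rewrite lerBlDr; move/ltW: hi; rewrite ler_pdivrMr // -natr1.
by rewrite mulrDl mul1r addrC.
Qed.

(** * Invariant of the loop over the grid *)

Section Method.
Variables (solve : socp_solver R) (solve_correct : socp_solver_correct solve).
Implicit Types b : option (point R n k * R).

Definition valued b := forall zw, b = Some zw ->
  PX_feasible G zw.1 /\ zw.2 = PX_obj G zw.1.

(** [None] dominates no point, so a final [None] refutes every slice met by the loop. *)
Definition dominates b z : Prop :=
  if b is Some zw then PX_obj G z <= zw.2 else False.

Definition keep_best b v :=
  let! s := solve_subproblemT solve G v in betterT b s.

Lemma keep_bestP b v : valued b -> let b' := val_of (keep_best b v) in
  [/\ valued b', forall z, dominates b z -> dominates b' z
    & forall z, PX_slice G v z -> dominates b' z].
Proof.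
move=> vb; rewrite /keep_best.
rewrite -[val_of _]/(val_of (betterT b (val_of (solve_subproblemT solve G v)))).
case: (solve_subproblemP G solve_correct v) => [noz|z zv zmax].
  by case: b vb => [zw|] vb; split=> // z /noz.
have vz : valued (Some (z, PX_obj G z)) by move=> _ [<-] /=; case: zv.
case: b vb => [[y w]|] vb //=.
by have [lt_wz|le_zw] /= := ltP w (PX_obj G z); split=> // z';
  [move/le_trans; apply; exact: ltW|move/zmax/le_trans; apply].
Qed.

(** Monotonicity of domination carries what one grid value achieved through the later iterations. *)
Lemma foldT_keep_best s b : valued b -> let b' := val_of (foldT keep_best b s) in
  [/\ valued b', forall z, dominates b z -> dominates b' z
    & forall v z, v \in s -> PX_slice G v z -> dominates b' z].
Proof.
elim: s b => [|v s IHs] b vb //=.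
have [vb' bb' vb2] := keep_bestP v vb.
have [? mono hs] := IHs _ vb'; split=> // [z bz|u z].
  exact/mono/bb'.
rewrite inE => /predU1P[-> zv|]; [exact/mono/vb2|exact: hs].
Qed.

Lemma methodT_approx eps : 0 < eps ->
  PX_approx G (DeltaD G tn * eps) (val_of (methodT solve G eps)).
Proof.
move=> eps0; rewrite -[val_of _]/(omap fst (val_of (foldT keep_best None (grid eps)))).
have [//|vb _ hb] := @foldT_keep_best (grid eps) None _.
move: vb hb; case: (val_of _) => [[z w]|] vb hb /=; last first.
  (* A feasible point would round down into some slice of the grid, whose points [None] would have
     to dominate. *)
  move=> z fz; have /(grid_below eps0)[v vg [v0 vc _]] : 0 <= cover z.1 tn <= 1.
    by case: z fz => p x [].
  have [|z' z'v _] := PX_slice_round_down (v := v) fz; first by rewrite v0.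
  exact: (hb _ _ vg z'v).
have [/= fz wE] := vb _ erefl; split=> //.
(* The returned point itself shows that $PX_n$ is feasible, hence has an optimum to compare with. *)
have [zo [fzo zomax]] := PX_optimal_exists (ex_intro _ z fz).
exists zo; split; first by split.
have /(grid_below eps0)[v vg [v0 vc vl]] : 0 <= cover zo.1 tn <= 1.
  by case: zo fzo {zomax} => p x [].
have [|z' z'v z'l] := PX_slice_round_down (v := v) fzo; first by rewrite v0.
have := hb _ _ vg z'v; rewrite /= wE; apply: le_trans; apply: le_trans z'l.
rewrite lerD2l lerN2 mulrC ler_wpM2l //.
by rewrite subr_ge0 UD_le.
Qed.

End Method.
End Correctness.

(** * Running time *)

Section Cost.
Local Open Scope nat_scope.

Lemma time_bind (A B : Type) (t : timed A) (f : A -> timed B) :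
  time_of (bind t f) = time_of t + time_of (f (val_of t)).
Proof. by []. Qed.

Lemma time_mxT (R : realType) m p (f : 'I_m -> 'I_p -> timed R) t :
  (forall i j, time_of (f i j) <= t) -> time_of (mxT f) <= m * (p * t.+1).
Proof.
move=> ft; rewrite /time_of /=.
rewrite -[X in _ <= X * _]card_ord -sum_nat_const; apply: leq_sum => i _.
rewrite -[X in _ <= X * _]card_ord -sum_nat_const; apply: leq_sum => j _.
exact: ft.
Qed.

Lemma time_sumT (R : realType) m (f : 'I_m -> timed R) t :
  (forall i, time_of (f i) <= t) -> time_of (sumT f) <= m * t.+2.
Proof.
move=> ft; rewrite /time_of /=.
rewrite -[X in _ <= X * _]card_ord -sum_nat_const; apply: leq_sum => i _.
exact: ft.
Qed.

Lemma time_collectT (A : Type) (s : seq (timed (option A))) t :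
  all (fun x => time_of x <= t) s -> time_of (collectT s) <= size s * t.+1.
Proof.
rewrite /collectT /time_of /=; elim: s => [|x s IHs] /=; first by rewrite big_nil.
by case/andP=> xt /IHs st; rewrite big_cons mulSn leq_add.
Qed.

Lemma all_time_map (I A : Type) (f : I -> timed (option A)) s (a : pred I) t :
  all a s -> (forall x, a x -> time_of (f x) <= t) ->
  all (fun x => time_of x <= t) [seq f x | x <- s].
Proof. by move=> sa ft; rewrite all_map; apply: sub_all sa => x /ft. Qed.

Lemma size_collectT (A : Type) (s : seq (timed (option A))) :
  size (val_of (collectT s)) <= size s.
Proof. by rewrite size_pmap count_size. Qed.

Lemma time_zeroT (R : realType) m p : time_of (zeroT R m p) <= m * p.
Proof. by rewrite -[p in X in _ <= X]muln1; exact: time_mxT. Qed.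

Lemma time_unitT (R : realType) q (l : 'I_q) : time_of (unitT R l) <= q * 2.
Proof. by rewrite -[X in _ <= X]mul1n; exact: time_mxT. Qed.

Section Slack.
Variables (R : realType) (N M : nat) (L : lsocp R N).
Hypotheses (M_gt0 : 0 < M) (N_le : N <= M) (eqs_le : size (ls_eqs L) <= M)
  (ineqs_le : size (ls_ineqs L) <= M) (cones_le : size (ls_cones L) <= M)
  (dims_le : all (fun C : soc R N => soc_dim C <= 2) (ls_cones L)).
Local Notation q := (size (ls_ineqs L)).

Let E := [seq let! Z := zeroT R 1 q in ret (Some (row_mx e.1 Z, e.2))
         | e <- ls_eqs L].
Let I := [seq let! u := unitT R l in
              let e := nth (0%R, 0%R) (ls_ineqs L) l in
              ret (Some (row_mx e.1 u, e.2)) | l <- enum 'I_q].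
Let C := [seq let! C' := lift_socT q C in ret (Some C') | C <- ls_cones L].
Let S := [seq let! C' := slack_socT R N l in ret (Some C') | l <- enum 'I_q].

Let size_rows : size (val_of (collectT E) ++ val_of (collectT I)) <= M + M.
Proof.
rewrite size_cat leq_add // (leq_trans (size_collectT _)) //.
  by rewrite size_map.
by rewrite size_map size_enum_ord.
Qed.

Let size_cones : size (val_of (collectT C) ++ val_of (collectT S)) <= M + M.
Proof.
rewrite size_cat leq_add // (leq_trans (size_collectT _)) //.
  by rewrite size_map.
by rewrite size_map size_enum_ord.
Qed.

(** A single [M] bounds the dimension and all list lengths. The pieces add up to $15M^2+9M$. *)
Lemma time_slack_formT : time_of (slack_formT L) <= 24 * (M * M).
Proof.
rewrite -[time_of _]/(time_of (zeroT R 1 q) + (time_of (collectT E) +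
  (time_of (collectT I) +
  (time_of (rowsT (val_of (collectT E) ++ val_of (collectT I))) +
  (time_of (collectT C) + (time_of (collectT S) + 0)))))).
have tZ := time_zeroT R 1 q.
have tE : time_of (collectT E) <= M * (M + 1).
  apply: (leq_trans (time_collectT (t := q) _)).
    apply: all_time_map (all_predT _) _ => e _.
    by rewrite !time_bind addn0 (leq_trans tZ) ?mul1n.
  by rewrite size_map leq_mul // addn1 ltnS.
have tI : time_of (collectT I) <= M * (2 * M + 1).
  apply: (leq_trans (time_collectT (t := q * 2) _)).
    by apply: all_time_map (all_predT _) _ => l _; rewrite !time_bind addn0 time_unitT.
  by rewrite size_map size_enum_ord leq_mul //; lia.
have tF : time_of (rowsT (val_of (collectT E) ++ val_of (collectT I)))
    <= (M + M) * (M + M) + (M + M).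
  rewrite /rowsT !time_bind addn0 leq_add //.
    apply: (leq_trans (time_mxT (t := 0) _)) => //.
    by rewrite leq_mul // muln1 leq_add.
  by apply: (leq_trans (time_mxT (t := 0) _)) => //; rewrite !muln1.
have tC : time_of (collectT C) <= M * (3 * M + 1).
  apply: (leq_trans (time_collectT (t := 3 * M) _)); last first.
    by rewrite size_map leq_mul //; lia.
  apply: all_time_map dims_le _ => c c2.
  rewrite /lift_socT !time_bind !addn0.
  have := time_zeroT R (soc_dim c) q.
  have : soc_dim c * q <= 2 * M by exact: leq_mul.
  by lia.
have tS : time_of (collectT S) <= M * (5 * M + 3).
  apply: (leq_trans (time_collectT (t := 5 * M + 2) _)); last first.
    by rewrite size_map size_enum_ord leq_mul //; lia.
  apply: all_time_map (all_predT _) _ => l _.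
  rewrite /slack_socT !time_bind !addn0.
  have := time_zeroT R 1 (N + q); have := time_zeroT R 1 1.
  have := time_zeroT R 1 N; have := time_unitT R l; lia.
have MM : M <= M * M by rewrite leq_pmulr.
by lia.
Qed.

Lemma socp_nb_slack_form : socp_nb (val_of (slack_formT L)) <= 26 * (M * M).
Proof.
rewrite /socp_nb -[socp_cones _]/(val_of (collectT C) ++ val_of (collectT S)).
rewrite -[socp_neq _]/(size (val_of (collectT E) ++ val_of (collectT I))).
have Nq : N + q <= M + M by exact: leq_add.
have cones9 : all (fun c => soc_nb c <= 9 * M)
    (val_of (collectT C) ++ val_of (collectT S)).
  rewrite all_cat !all_collectT all_map [X in _ && X]all_map; apply/andP; split.
    apply: sub_all dims_le => c c2 /=; rewrite /soc_nb /=.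
    have : soc_dim c * (N + q) <= 2 * (M + M) by exact: leq_mul.
    by lia.
  by apply/allT => l /=; rewrite /soc_nb /=; lia.
have : \sum_(c <- val_of (collectT C) ++ val_of (collectT S)) soc_nb c
    <= (M + M) * (9 * M).
  apply: leq_trans (leq_mul size_cones (leqnn _)).
  elim: (_ ++ _) cones9 => [|c s IHs]; first by rewrite big_nil.
  by case/andP=> ? /IHs ?; rewrite big_cons /= mulSn leq_add.
have : size (val_of (collectT E) ++ val_of (collectT I)) * (N + q)
    <= (M + M) * (M + M) by exact: leq_mul.
have MM : M <= M * M by rewrite leq_pmulr.
lia.
Qed.

End Slack.

Section Subproblem.
Variables (R : realType) (n k : nat) (G : audit_game R n k) (v : R).
Hypothesis k_lt : k < n.+1.
Local Notation W := (n.+1 * n.+1).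
Local Notation dim := (k * n.+1 + n.+1).

(** The dimension is $(k+1)(n+1)$; this is where fewer resources than targets matters. *)
Lemma dim_le : dim <= W.
Proof. by rewrite addnC -mulSn leq_mul. Qed.

Lemma target_le : n.+1 <= W.
Proof. exact: leq_pmulr. Qed.

Lemma W_le : W <= W * W.
Proof. exact: leq_pmulr. Qed.

Lemma time_formT (al : 'I_k -> 'I_n.+1 -> timed R) be :
  (forall j i, time_of (al j i) <= 2) -> (forall i, time_of (be i) <= 2) ->
  time_of (formT al be) <= 3 * W.
Proof.
move=> ha hb; rewrite /formT !time_bind addn0.
have := time_mxT ha; have := @time_mxT R 1 n.+1 (fun _ => be) 2 (fun _ => hb).
by have := dim_le; lia.
Qed.

Lemma time_selformT J s I t :
  time_of (selformT J s I t : timed 'rV[R]_dim) <= 3 * W.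
Proof. exact: time_formT. Qed.

Lemma time_constrT J s I t b :
  time_of (constrT (selformT J s I t : timed 'rV[R]_dim) b) <= 3 * W.
Proof. by rewrite /constrT time_bind addn0 time_selformT. Qed.

Lemma time_objT : time_of (objT G) <= 4 * W.
Proof.
rewrite /objT time_bind [time_of (tick _)]/=.
apply: (leq_trans (leq_add (leqnn 1) (time_formT _ _))) => //.
by lia.
Qed.

Lemma size_eqsT : size (val_of (eqsT G v)) <= 3 * W.
Proof.
apply: (leq_trans (size_collectT _)); rewrite size_cat size_allpairs !size_enum_ord /=.
by have := dim_le; lia.
Qed.

Lemma time_eqsT : time_of (eqsT G v) <= 15 * (W * W).
Proof.
apply: (leq_trans (time_collectT (t := 4 * W) _)); last first.
  apply: (@leq_trans (3 * W * (4 * W).+1)); last by have := W_le; lia.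
  rewrite leq_mul // size_cat size_allpairs !size_enum_ord /=.
  by have := dim_le; lia.
rewrite all_cat; apply/andP; split.
  by apply/and3P; split=> //; apply: leq_trans (time_constrT _ _ _ _ _) _; lia.
apply/all_allpairsP => j i _ _; rewrite time_bind [time_of (tick _)]/=.
case: ifP => _; last by rewrite [time_of _]/=; lia.
by apply: leq_trans (leq_add (leqnn 1) (time_constrT _ _ _ _ _)) _; lia.
Qed.

Lemma size_ineqsT : size (val_of (ineqsT R n k)) <= 7 * W.
Proof.
apply: (leq_trans (size_collectT _)).
rewrite !size_cat !size_map size_allpairs -!enumT !size_enum_ord /=.
by have := dim_le; lia.
Qed.

Lemma time_ineqsT : time_of (ineqsT R n k) <= 28 * (W * W).
Proof.
apply: (leq_trans (time_collectT (t := 3 * W) _)); last first.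
  apply: (@leq_trans (7 * W * (3 * W).+1)); last by have := W_le; lia.
  rewrite leq_mul // !size_cat !size_map size_allpairs -!enumT !size_enum_ord /=.
  by have := dim_le; lia.
rewrite !all_cat; do 6?[apply/andP; split];
  try by [apply: all_time_map (all_predT _) _ => ? _; exact: time_constrT].
by apply/all_allpairsP => j i _ _; exact: time_constrT.
Qed.

Lemma time_coneT i : time_of (coneT G v i) <= 18 * W.
Proof.
have -> : time_of (coneT G v i) =
    if i != ord_max then if (0 <= cone_lhs G v i)%R then
      (* Scalar steps taken: 11 if the cone is built, 7 up to the sign test, 1 for target $n$. *)
      11 + (time_of (zeroT R 1 dim) + (time_of (pixiT k i (1 : R)%R (-1)%R) +
        (time_of (pixiT k i (1 : R)%R 1%R) + 0))) else 7 else 1.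
  rewrite /coneT; case: (i != _) => //; rewrite /cone_lhs.
  by case E0: (0 <= _)%R; rewrite /time_of /= E0.
have := time_zeroT R 1 dim; have := dim_le.
have := time_selformT (fun _ i' => i' == i) 1%R (pred1 i) 1%R.
have := time_selformT (fun _ i' => i' == i) 1%R (pred1 i) (-1)%R.
by rewrite /pixiT; case: ifP => _; [case: ifP => _|]; lia.
Qed.

Lemma time_subproblemT : time_of (subproblemT G v) <= 66 * (W * W).
Proof.
rewrite -[time_of _]/(time_of (objT G) + (time_of (eqsT G v) +
  (time_of (ineqsT R n k) +
  (time_of (collectT [seq coneT G v i | i <- enum 'I_n.+1]) + 0)))).
have tC : time_of (collectT [seq coneT G v i | i <- enum 'I_n.+1]) <= 19 * (W * W).
  apply: (leq_trans (time_collectT (t := 18 * W) _)).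
    by apply: all_time_map (all_predT _) _ => i _; exact: time_coneT.
  rewrite size_map size_enum_ord.
  apply: leq_trans (leq_mul target_le (leqnn _)) _.
  by have := W_le; lia.
have := time_objT; have := time_eqsT; have := time_ineqsT; have := W_le; lia.
Qed.

Lemma size_conesT :
  size (val_of (collectT [seq coneT G v i | i <- enum 'I_n.+1])) <= W.
Proof.
apply: (leq_trans (size_collectT _)); rewrite size_map size_enum_ord.
exact: target_le.
Qed.

Lemma soc_dim_conesT : all (fun C : soc R dim => soc_dim C <= 2)
  (val_of (collectT [seq coneT G v i | i <- enum 'I_n.+1])).
Proof.
rewrite all_collectT all_map; apply/allT => i.
by rewrite /preim -[is_true _]/(is_true (if val_of (coneT G v i) is Some C then
  soc_dim C <= 2 else true)) coneT_val; case: ifP.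
Qed.

Let P := slack_formT (val_of (subproblemT G v)).

(** The list of inequalities has the largest bound, $7W$, so [M] is $7W$ and the constant is
    $24\cdot 49$. *)
Lemma time_subproblem_slack : time_of P <= 1176 * (W * W).
Proof.
have := @time_slack_formT R dim (7 * W) (val_of (subproblemT G v)).
have := dim_le; have := size_eqsT; have := size_ineqsT; have := size_conesT.
move=> h1 h2 h3 h4 h.
have := h _ _ _ _ _ soc_dim_conesT; rewrite -/P.
have -> : 24 * (7 * W * (7 * W)) = 1176 * (W * W) by lia.
apply; rewrite ?(leq_trans h1) ?(leq_trans h2) ?(leq_trans h3) ?(leq_trans h4) //; lia.
Qed.

Lemma nb_subproblem_slack : socp_nb (val_of P) <= 1274 * (W * W).
Proof.
have := @socp_nb_slack_form R dim (7 * W) (val_of (subproblemT G v)).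
have := dim_le; have := size_eqsT; have := size_ineqsT; have := size_conesT.
move=> h1 h2 h3 h4 h.
have := h _ _ _ _ _ soc_dim_conesT; rewrite -/P.
have -> : 26 * (7 * W * (7 * W)) = 1274 * (W * W) by lia.
apply; rewrite ?(leq_trans h1) ?(leq_trans h2) ?(leq_trans h3) ?(leq_trans h4) //; lia.
Qed.

Lemma time_extractT q (y : 'cV[R]_(dim + q)) : time_of (extractT y) <= W.
Proof.
rewrite /extractT !time_bind addn0; apply: leq_trans dim_le.
apply: leq_add; apply: leq_trans (time_mxT (t := 0) _) _ => //; by rewrite ?mul1n muln1.
Qed.

Lemma time_valueT (z : point R n k) : time_of (valueT G z) <= 8 * W.
Proof.
rewrite /valueT !time_bind.
have := @time_sumT R k (fun j => ret (z.1 j ord_max)) 0 (fun _ => leqnn _).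
have := @time_sumT R n.+1 (fun i => tick (prate G i * z.2 0 i)%R) 1 (fun _ => leqnn _).
have := dim_le; rewrite ![time_of (tick _)]/=; lia.
Qed.

Variable solve : socp_solver R.

(** Here $1252=66+1176+9+1$: building the subproblem, its slack form, reading the answer, one
    comparison. *)
Lemma time_keep_best b :
  time_of (keep_best G solve b v) <=
    1252 * (W * W) + time_of (solve (val_of P)).
Proof.
have tb s : time_of (betterT b s) <= 1 by case: b s => [zw|] [zw'|].
pose answer : timed (option (point R n k * R)) :=
  if val_of (solve (val_of P)) is Some y then
    let! z := extractT y in let! val := valueT G z in ret (Some (z, val))
  else ret None.
have ta : time_of answer <= 9 * W.
  rewrite /answer; case: (val_of _) => [y|] //.
  rewrite -[time_of _]/(time_of (extractT y) +
    (time_of (valueT G (val_of (extractT y))) + 0)).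
  by have := time_extractT y; have := time_valueT (val_of (extractT y)); lia.
rewrite -[time_of _]/((time_of (subproblemT G v) + (time_of P +
  (time_of (solve (val_of P)) + time_of answer))) +
  time_of (betterT b (val_of (solve_subproblemT solve G v)))).
have := tb (val_of (solve_subproblemT solve G v)).
have := time_subproblemT; have := time_subproblem_slack; have := W_le; lia.
Qed.

End Subproblem.
End Cost.

(** * Size of the data *)

Section Magnitude.
Variable R : realType.

Lemma mx_leP (M : R) m p (A : 'M[R]_(m, p)) :
  reflect (forall i j, `|A i j| <= M) (mx_le M A).
Proof.
by apply: (iffP forallP) => h i; [move=> j; exact: (forallP (h i))
                                 |apply/forallP].
Qed.

Lemma mx_le_row_mx (M : R) m p1 p2 (A : 'M[R]_(m, p1)) (B : 'M[R]_(m, p2)) :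
  mx_le M A -> mx_le M B -> mx_le M (row_mx A B).
Proof.
move=> /mx_leP hA /mx_leP hB; apply/mx_leP => i j.
by rewrite mxE; case: splitP.
Qed.

Lemma mx_le_col_mx (M : R) m1 m2 p (A : 'M[R]_(m1, p)) (B : 'M[R]_(m2, p)) :
  mx_le M A -> mx_le M B -> mx_le M (col_mx A B).
Proof.
move=> /mx_leP hA /mx_leP hB; apply/mx_leP => i j.
by rewrite mxE; case: splitP.
Qed.

Lemma mx_le_const (M a : R) m p : `|a| <= M -> mx_le M (const_mx a : 'M_(m, p)).
Proof. by move=> aM; apply/mx_leP => i j; rewrite mxE. Qed.

Lemma mx_le_zeroT (M : R) m p : 0 <= M -> mx_le M (val_of (zeroT R m p)).
Proof. by move=> M0; rewrite zeroTE; apply/mx_leP => i j; rewrite mxE normr0. Qed.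

Lemma mx_le_unitT (M : R) q (l : 'I_q) : 1 <= M -> mx_le M (val_of (unitT R l)).
Proof.
move=> M1; apply/mx_leP => i j; rewrite mxE /=.
by case: (j == l); rewrite ?normr1 // normr0 (le_trans ler01).
Qed.

Definition row_le N (M : R) (e : 'rV[R]_N * R) := mx_le M e.1 && (`|e.2| <= M).

Lemma rowsT_le (M : R) N (s : seq ('rV[R]_N * R)) : all (row_le M) s ->
  mx_le M (val_of (rowsT s)).1 && mx_le M (val_of (rowsT s)).2.
Proof.
move=> /(all_nthP (0, 0)) h; apply/andP; split; apply/mx_leP => l j;
  rewrite mxE; have /andP[/mx_leP h1 h2] := h l (ltn_ord l).
  exact: h1.
exact: h2.
Qed.

Definition lsocp_le N (M : R) (L : lsocp R N) :=
  [&& mx_le M (ls_f L), all (row_le M) (ls_eqs L), all (row_le M) (ls_ineqs L)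
    & all (soc_le M) (ls_cones L)].

(** The bound must be at least 1 because the slack columns contain ones. *)
Lemma slack_form_le (M : R) N (L : lsocp R N) :
  1 <= M -> lsocp_le M L -> socp_le M (val_of (slack_formT L)).
Proof.
move=> M1 /and4P[hf hE /(all_nthP (0, 0)) hI hC].
have M0 : 0 <= M by lra.
pose E := [seq let! Z := zeroT R 1 (size (ls_ineqs L)) in
               ret (Some (row_mx e.1 Z, e.2)) | e <- ls_eqs L].
pose I := [seq let! u := unitT R l in
               let e := nth (0, 0) (ls_ineqs L) l in
               ret (Some (row_mx e.1 u, e.2)) | l <- enum 'I_(size (ls_ineqs L))].
pose Fg := val_of (rowsT (val_of (collectT E) ++ val_of (collectT I))).
have /andP[hF hg] : mx_le M Fg.1 && mx_le M Fg.2.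
  apply: rowsT_le; rewrite all_cat !all_collectT all_map [X in _ && X]all_map.
  apply/andP; split.
    apply: sub_all hE => e /andP[e1 e2]; apply/andP; split=> //.
    by apply: mx_le_row_mx => //; exact: mx_le_zeroT.
  apply/allT => l; have /andP[e1 e2] := hI l (ltn_ord l).
  by apply/andP; split=> //; apply: mx_le_row_mx => //; exact: mx_le_unitT.
apply/and4P; split=> //.
  by apply: mx_le_row_mx => //; exact: mx_le_zeroT.
rewrite all_cat !all_collectT all_map [X in _ && X]all_map; apply/andP; split.
  apply: sub_all hC => c /and4P[hA hb hc hd]; apply/and4P; split=> //;
    by apply: mx_le_row_mx => //; exact: mx_le_zeroT.
apply/allT => l; apply/and4P; split; try exact: mx_le_zeroT.
  by apply: mx_le_row_mx; [exact: mx_le_zeroT|exact: mx_le_unitT].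
by rewrite normr0.
Qed.

(** Placing the binary point divides by some $2^e\ge 1$, which only shrinks the magnitude. *)
Lemma Kbit_le K (x : R) : Kbit K x -> `|x| <= 2 ^+ K.
Proof.
case=> m [e [mK _ ->]]; have e1 : 1 <= 2 ^+ e :> R by rewrite exprn_ege1 ?ler1n.
rewrite normrM normfV [`|2 ^+ e|]ger0_norm ?(le_trans _ e1) //.
rewrite ler_pdivrMr ?(lt_le_trans _ e1) // -intr_norm.
apply: (@le_trans _ _ (2 ^+ K)); last by rewrite ler_peMr // exprn_ge0.
by rewrite -abszE -natrX pmulrn ler_nat ltnW.
Qed.

End Magnitude.

Section SubproblemMagnitude.
Variables (R : realType) (n k K : nat) (G : audit_game R n k).
Hypothesis G_Kbit : game_Kbit K G.
Local Notation dim := (k * n.+1 + n.+1)%N.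
Local Notation tn := (@ord_max n).
Local Notation M := (2 ^+ (K + 3) : R).

Let K_ge1 : 1 <= 2 ^+ K :> R.
Proof. by rewrite exprn_ege1 ?ler1n. Qed.

Let M_E : M = 2 ^+ K * 8.
Proof. by rewrite exprD; congr (_ * _); rewrite !exprS expr0; lra. Qed.

Let M_ge1 : 1 <= M.
Proof. by have := K_ge1; rewrite M_E; lra. Qed.

Lemma game_le i : [/\ `|UDa G i| <= 2 ^+ K, `|UDu G i| <= 2 ^+ K,
  `|UAa G i| <= 2 ^+ K, `|UAu G i| <= 2 ^+ K & `|prate G i| <= 2 ^+ K].
Proof. by have [*] := G_Kbit i; split; exact: Kbit_le. Qed.

Lemma DeltaD_le i : 0 <= DeltaD G i <= 2 * 2 ^+ K.
Proof.
rewrite subr_ge0 UD_le /DeltaD /=.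
by have [] := game_le i; rewrite !ler_norml; lra.
Qed.

Lemma Delta_le i : 0 <= Delta G i <= 2 * 2 ^+ K.
Proof.
rewrite subr_ge0 UA_le /Delta /=.
by have [] := game_le i; rewrite !ler_norml; lra.
Qed.

Lemma formT_le al be : (forall j i, `|val_of (al j i)| <= M) ->
  (forall i, `|val_of (be i)| <= M) ->
  mx_le M (val_of (formT al be) : 'rV[R]_dim).
Proof.
move=> ha hb; apply: mx_le_row_mx; apply/mx_leP => i l; last by rewrite mxE.
by case/mxvec_indexP: l => j l; rewrite (ord1 i) mxvecE mxE.
Qed.

Lemma selformT_le J s I t : `|s| <= M -> `|t| <= M ->
  mx_le M (val_of (selformT J s I t) : 'rV[R]_dim).
Proof.
move=> hs ht; have M0 : 0 <= M by exact: le_trans M_ge1.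
by apply: formT_le => [j i|i] /=; case: ifP; rewrite ?normr0.
Qed.

Lemma cone_lhs_le v i : 0 <= v <= 1 -> cone_lhs G v i <= 4 * 2 ^+ K.
Proof.
move=> /andP[v0 v1]; rewrite /cone_lhs add0r /delta.
have /andP[D0 D2] := Delta_le tn.
have : v * Delta G tn <= Delta G tn by exact: ler_piMl.
have [_ _ _ + _] := game_le i; have [_ _ _ + _] := game_le tn.
by rewrite !ler_norml; lra.
Qed.

Lemma subproblem_le v : 0 <= v <= 1 -> lsocp_le M (val_of (subproblemT G v)).
Proof.
move=> v01; have /andP[v0 v1] := v01.
have K1 := K_ge1.
have nM1 : `|1 : R| <= M by rewrite normr1.
have nM0 : `|0 : R| <= M by rewrite normr0 (le_trans ler01).
have nMN1 : `|-1 : R| <= M by rewrite normrN1.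
have sel J s I t b : `|s| <= M -> `|t| <= M -> `|b| <= M ->
    row_le M (val_of (selformT J s I t) : 'rV[R]_dim, b).
  by move=> ? ? ?; rewrite /row_le selformT_le.
apply/and4P; split.
- apply: formT_le => [j i|i] /=.
    case: ifP => // _; have /andP[D0 D2] := DeltaD_le tn.
    by rewrite ger0_norm // M_E; lra.
  by rewrite normrN; have [_ _ _ _] := game_le i; rewrite M_E; lra.
- rewrite -[ls_eqs _]/(val_of (eqsT G v)) all_collectT all_cat; apply/andP; split.
    apply/and3P; split=> //; apply: sel => //.
    by rewrite ger0_norm // (le_trans v1).
  apply/all_allpairsP => j i _ _.
  by have [fji|nfji] := boolP (forbidden G j i); first exact: sel.
- rewrite -[ls_ineqs _]/(val_of (ineqsT R n k)) all_collectT !all_cat.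
  do 6?[apply/andP; split];
    try by [rewrite all_map; apply/allT => ?; exact: sel].
  by apply/all_allpairsP => j i _ _; exact: sel.
rewrite -[ls_cones _]/(val_of (collectT [seq coneT G v i | i <- enum 'I_n.+1])).
rewrite all_collectT all_map; apply/allT => i.
rewrite /preim -[is_true _]/(is_true (if val_of (coneT G v i) is Some C then
  soc_le M C else true)) coneT_val; case: ifP => // /andP[_ w0].
have /andP[D0 D2] := Delta_le i.
have DM : `|Delta G i| <= M by rewrite ger0_norm // M_E; lra.
apply/and4P; split=> //; last exact: selformT_le.
  apply: mx_le_col_mx; last exact: selformT_le.
  by apply: mx_le_zeroT; exact: le_trans M_ge1.
apply: mx_le_col_mx; apply: mx_le_const; last by rewrite normrN.
rewrite ger0_norm ?mulr_ge0 ?sqrtr_ge0 //.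
have w4 := cone_lhs_le i v01.
(* A crude bound by $t\le t^2$ for $t\ge 1$. It gives $\kappa_i\le 8\cdot 2^K$, the origin of the
   exponent $K+3$. *)
have : Num.sqrt (cone_lhs G v i) <= 4 * 2 ^+ K.
  rewrite -ler_sqr ?nnegrE ?sqrtr_ge0 ?mulr_ge0 ?exprn_ge0 // sqr_sqrtr //.
  by apply: le_trans w4 _; rewrite expr2 ler_peMl //; lra.
by rewrite M_E; lra.
Qed.

End SubproblemMagnitude.

(** * Total running time *)

Lemma Kbit_gt0 (R : realType) (K : nat) (x : R) : Kbit K x -> 0 < x -> (0 < K)%N.
Proof.
case: K => // -[m [e [+ _ ->]]]; rewrite expn0 ltnS leqn0 absz_eq0 => /eqP ->.
by rewrite mul0r ltxx.
Qed.

(** The predicate [a] will be [0 <= v <= 1]: the data of a subproblem, and with them the time of the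
    solver, are bounded only for such [v]. *)
Lemma time_foldT (A B : Type) (f : B -> A -> timed B) b (s : seq A) t
    (a : pred A) : all a s ->
  (forall b v, a v -> time_of (f b v) <= t)%N ->
  (time_of (foldT f b s) <= size s * t.+1)%N.
Proof.
move=> + ft; elim: s b => [|v s IHs] b // /andP[av sa].
rewrite -[time_of _]/(time_of (f b v) +
  (1 + time_of (foldT f (val_of (f b v)) s)))%N.
by rewrite mulSn addnA addn1 leq_add ?ltnS ?ft ?IHs.
Qed.

Lemma grid_le1 (R : realType) (eps v : R) :
  0 < eps -> v \in grid eps -> 0 <= v <= 1.
Proof.
move=> eps0 /mapP[m]; rewrite mem_iota add0n ltnS /= => mt ->.
rewrite -mulr_natl mulr_ge0 ?ler0n ?(ltW eps0) //= -ler_pdivlMr // mul1r.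
by rewrite -truncn_ge_nat // invr_ge0 ltW.
Qed.

Section MethodTime.
Variables (R : realType) (solve : socp_solver R) (c d : nat).
Hypothesis solve_time : forall N (P : socp R N) (B : nat), socp_le (2 ^+ B) P ->
  (time_of (@solve N P) <= c * (socp_nb P + B).+1 ^ d)%N.
Variables (n k K : nat) (G : audit_game R n k).
Hypotheses (k_lt : (k < n.+1)%N) (G_Kbit : game_Kbit K G).

(** With $Z=(n+1)^4$, the argument of the solver's polynomial is at most
    $1274Z+(K+3)+1\le(1278+K)Z$. The exponent $d+1$ covers both $Z^d$ and the linear cost in $Z$ of
    the other steps. *)
Lemma time_keep_best_le b v : 0 <= v <= 1 ->
  (time_of (keep_best G solve b v) <=
   (1252 + c * (1278 + K) ^ d) * (n.+1 ^ 4) ^ d.+1)%N.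
Proof.
move=> v01; apply: leq_trans (time_keep_best _ _ k_lt _ _) _.
have WE : (n.+1 ^ 4 = n.+1 * n.+1 * (n.+1 * n.+1))%N by rewrite !expnS expn0; lia.
rewrite -WE; set Z := (n.+1 ^ 4)%N.
have Z0 : (0 < Z)%N by rewrite expn_gt0.
rewrite mulnDl; apply: leq_add.
  by rewrite leq_mul2l expnS leq_pmulr ?expn_gt0 ?Z0.
apply: leq_trans (solve_time (B := K + 3) _) _.
  by apply: slack_form_le (subproblem_le G_Kbit v01); rewrite exprn_ege1 ?ler1n.
rewrite -mulnA leq_mul2l; apply/orP; right.
apply: (@leq_trans (((1278 + K) * Z) ^ d)%N); last first.
  by rewrite expnMn leq_mul2l leq_pexp2l ?orbT.
have := nb_subproblem_slack G v k_lt; rewrite -WE -/Z => nbZ.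
by case: d => // d'; rewrite leq_exp2r //; nia.
Qed.

Lemma time_methodT eps : 0 < eps ->
  (time_of (methodT solve G eps) <=
   size (grid eps) * ((1257 + c * (1278 + K) ^ d) * (n.+1 ^ 4) ^ d.+1))%N.
Proof.
move=> eps0; set a := (c * _)%N; set Z := ((n.+1 ^ 4) ^ d.+1)%N.
have Z0 : (0 < Z)%N by rewrite !expn_gt0.
have -> : time_of (methodT solve G eps) = ((3 * size (grid eps)).+1 +
    time_of (foldT (keep_best G solve) None (grid eps)))%N.
  by rewrite -[LHS]/(_ + (_ + 0))%N addn0.
have s0 : (0 < size (grid eps))%N by rewrite size_map size_iota.
have := @time_foldT _ _ (keep_best G solve) None (grid eps)
  ((1252 + a) * Z) (fun v => 0 <= v <= 1).
move=> /(_ _ time_keep_best_le) h.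
have {}h := h (introT allP (fun v vg => grid_le1 eps0 vg)).
apply: leq_trans (leq_add (leqnn _) h) _.
move: (size _) s0 => s s0.
(* Listing the grid costs $3s+1\le 4s$ and each iteration one more step, whence $1257=1252+5$. *)
apply: (@leq_trans (s * (4 + ((1252 + a) * Z).+1))); first by nia.
by rewrite leq_mul2l; apply/orP; right; nia.
Qed.

End MethodTime.

Theorem theorem2 (R : realType) (solve : socp_solver R)
    (solve_correct : socp_solver_correct solve)
    (solve_polytime : socp_solver_polytime solve) :
  exists d : nat, forall K : nat, exists (c : nat) (C : R),
    forall (n k : nat) (G : audit_game R n k) (eps : R),
      (k < n.+1)%N -> game_Kbit K G -> 0 < eps ->
      PX_approx G (C * eps) (val_of (methodT solve G eps)) /\
      (time_of (methodT solve G eps))%:R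
        <= c%:R * ((input_size n k K)%:R + eps^-1) ^+ d.
Proof.
have [c [d solve_time]] := solve_polytime.
(* The exponent is fixed before [K]: $4(d+1)$ for the powers of $n+1$, and one for the number of
   grid points. *)
exists (4 * d.+1).+1 => K.
exists (1257 + c * (1278 + K) ^ d)%N, (2 * 2 ^+ K) => n k G eps k_lt G_Kbit eps0.
split.
  have := methodT_approx G solve_correct eps0; case: (val_of _) => //= z.
  case=> fz [zo [opt zo_le]]; split=> //; exists zo; split=> //.
  apply: le_trans zo_le; rewrite lerD2l lerN2 ler_pM2r //.
  by have /andP[] := DeltaD_le G_Kbit ord_max.
(* A positive punishment rate cannot be written with 0 bits; without $K>0$ the input size need not
   dominate $n+1$. *)
have K0 : (0 < K)%N.
  have [_ _ _ _ /Kbit_gt0] := G_Kbit ord_max; apply; exact: prate_gt0.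
set X := _ + eps^-1.
have nS : (n.+1 <= input_size n k K)%N by rewrite /input_size; nia.
have e0 : 0 <= eps^-1 by rewrite invr_ge0 ltW.
have nX : n.+1%:R <= X by rewrite -[leLHS]addr0 lerD // ler_nat.
(* The grid point 0 adds one to the integer part of $1/\epsilon$; the input size, being at least 1,
   absorbs it. *)
have gX : (size (grid eps))%:R <= X.
  rewrite size_map size_iota -natr1 addrC lerD ?truncn_le //.
  by rewrite ler1n (leq_trans _ nS).
have X0 : 0 <= X by exact: le_trans nX.
have := time_methodT solve_time k_lt G_Kbit eps0; rewrite -(ler_nat R).
move=> /le_trans; apply; rewrite -expnM !natrM natrX mulrCA.
apply: ler_wpM2l; first exact: ler0n.
rewrite [leRHS]exprS; apply: ler_pM => //; first exact: exprn_ge0.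
by rewrite lerXn2r // nnegrE ler0n.
Qed.
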